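(* $H^*(X;\mathbb{E})\cong H^*(X_0;\mathbb{E}_0)$.
   Context: Let $D=G/K$ be a non-compact symmetric space, where $G$ is the group of real points of a semisimple linear algebraic group defined over $\mathbb{Q}$, and let $\Gamma$ be an arithmetic subgroup of $G(\mathbb{Q})$. Let $D_0\subset D$ be a spine, i.e. a $\Gamma$-equivariant deformation retract of $D$ of dimension equal to the virtual cohomological dimension of $\Gamma$, with a CW-structure such that the $\Gamma$-stabilizer of a cell fixes the cell pointwise. Let $\tilde r:D\to D_0$ be the $\Gamma$-equivariant deformation retraction. Put $X=\Gamma\backslash D$, $X_0=\Gamma\backslash D_0$, with projections $\pi:D\to X$ and $\pi_0:D_0\to X_0$. Let $(E,\rho)$ be a $\Gamma$-module, with action $\rho:\Gamma\to\mathrm{GL}(E)$. Let $\mathbb{E}$ be the sheaf on $X$ associated to the presheaf $U\mapsto\{f:\pi^{-1}(U)\to E : f \text{ locally constant},\ f(\gamma\cdot x)=\rho(\gamma)f(x)\ \forall\gamma\in\Gamma,\ x\in\pi^{-1}(U)\}$, and let $\mathbb{E}_0$ be the sheaf on $X_0$ defined in the same way with $\pi_0$ in place of $\pi$. $H^*$ denotes sheaf cohomology. $\Gamma$ is allowed to have torsion. *)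

(* Defs.v *)
From HB Require Import structures.
From mathcomp Require Import all_boot all_order all_algebra.
From mathcomp Require Import all_classical all_reals topology.
From mathcomp Require Import normedtype.
From mathcomp.real_closed Require Import complex.
From mathcomp Require mpoly.

Set Implicit Arguments.
Unset Strict Implicit.
Unset Printing Implicit Defensive.
Import Order.TTheory GRing.Theory Num.Theory numFieldNormedType.Exports.

Local Open Scope classical_set_scope.
Local Open Scope quotient_scope.
Local Open Scope ring_scope.

Record subgroup (G : groupType) := Subgroup {
  sg_set :> set G;
  sg1 : sg_set 1%g;
  sgM : forall x y, sg_set x -> sg_set y -> sg_set (x * y)%g;
  sgV : forall x, sg_set x -> sg_set (x^-1)%g }.

Definition elt (G : groupType) (H : subgroup G) : Type := set_type H.

Section Elt.
Variables (G : groupType) (H : subgroup G).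

HB.instance Definition _ := SubChoice.copy (elt H) (set_type H).

Fact elt_group_closed : group_closed (fun x : G => x \in sg_set H).
Proof.
split; first by rewrite inE; exact: sg1.
move=> x y; rewrite !inE => Hx Hy; apply: sgM => //; exact: sgV.
Qed.

HB.instance Definition _ :=
  SubChoice_isSubGroup.Build G (fun x : G => x \in sg_set H) (elt H)
    elt_group_closed.
End Elt.

Record action (G : groupType) (Y : Type) := Action {
  act :> G -> Y -> Y;
  act1 : forall y, act 1%g y = y;
  actM : forall g h y, act (g * h)%g y = act g (act h y) }.

(* [A] is meant to be a subgroup contained in [B]. *)
Definition finite_index (G : groupType) (A B : set G) : Prop :=
  exists s : seq G, forall x, B x -> exists2 c, c \in s & A (c^-1 * x)%g.

Definition commensurable (G : groupType) (A B : set G) : Prop :=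
  finite_index (A `&` B) A /\ finite_index (A `&` B) B.

Definition torsion_free (G : groupType) : Prop :=
  forall (g : G) (n : nat), (0 < n)%N -> (g ^+ n = 1)%g -> g = 1%g.

Definition normal_in (G : groupType) (N H : set G) : Prop :=
  N `<=` H /\ forall x y, N x -> H y -> N (x ^ y)%g.

Definition derived (G : groupType) (A : set G) : set G :=
  [set x | forall L : subgroup G,
     (forall a b, A a -> A b -> sg_set L [~ a, b]%g) -> sg_set L x].

Definition solvable_set (G : groupType) (A : set G) : Prop :=
  exists m, iter m (@derived G) A `<=` [set 1%g].

Section GroupCohomology.
Variables (G : groupType) (M : zmodType) (rho : G -> {additive M -> M}).

(* Differential of the inhomogeneous cochain complex.  [lift ord0] and
   [widen_ord] are the maps i |-> i + 1 and i |-> i from 'I_n to 'I_n.+1. *)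
Definition cobord (n : nat) (f : ('I_n -> G) -> M) (g : 'I_n.+1 -> G) : M :=
  rho (g ord0) (f (fun i => g (lift ord0 i)))
  + \sum_(j < n)
      f (fun i => let g0 := g (widen_ord (leqnSn n) i) in
                  let g1 := g (lift ord0 i) in
                  if (i < j)%N then g0 else
                  if i == j then (g0 * g1)%g else g1) *~ ((-1) ^+ j.+1)
  + f (fun i => g (widen_ord (leqnSn n) i)) *~ ((-1) ^+ n.+1).

Definition cohomology_vanishes_succ (n : nat) : Prop :=
  forall f : ('I_n.+1 -> G) -> M,
    (forall g, cobord f g = 0) -> exists h, cobord h = f.
End GroupCohomology.

Definition cd_le (G : groupType) (d : nat) : Prop :=
  forall (M : zmodType) (rho : G -> {additive M -> M}),
    (forall x, rho 1%g x = x) ->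
    (forall g h x, rho (g * h)%g x = rho g (rho h x)) ->
    forall n, (d <= n)%N -> cohomology_vanishes_succ rho n.

Definition is_cd (G : groupType) (d : nat) : Prop :=
  cd_le G d /\ forall d', cd_le G d' -> (d <= d')%N.

(* By Serre's theorem all torsion-free subgroups of finite index have the same
   cohomological dimension, so any one of them can be used. *)
Definition is_vcd (G : groupType) (d : nat) : Prop :=
  exists H : subgroup G,
    [/\ finite_index H setT, torsion_free (elt H) & is_cd (elt H) d].

Definition GL (n : nat) (F : fieldType) : Type := {g : 'M[F]_n | g \in unitmx}.

Section GLGroup.
Variables (n : nat) (F : fieldType).

HB.instance Definition _ :=
  SubChoice.copy (GL n F) {g : 'M[F]_n | g \in unitmx}.

Definition GL_one : GL n F := exist (fun M => M \in unitmx) 1%:M (unitmx1 F n).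
Fact GL_mul_subproof (g h : GL n F) : val g *m val h \in unitmx.
Proof. by rewrite unitmx_mul (valP g) (valP h). Qed.
Definition GL_mul (g h : GL n F) : GL n F := exist (fun M => M \in unitmx) _ (GL_mul_subproof g h).
Fact GL_inv_subproof (g : GL n F) : invmx (val g) \in unitmx.
Proof. by rewrite unitmx_inv (valP g). Qed.
Definition GL_inv (g : GL n F) : GL n F := exist (fun M => M \in unitmx) _ (GL_inv_subproof g).

Fact GL_mulA : associative GL_mul.
Proof. by move=> x y z; apply: val_inj; rewrite /= mulmxA. Qed.
Fact GL_mul1g : left_id GL_one GL_mul.
Proof. by move=> x; apply: val_inj; rewrite /= mul1mx. Qed.
Fact GL_mulg1 : right_id GL_one GL_mul.
Proof. by move=> x; apply: val_inj; rewrite /= mulmx1. Qed.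
Fact GL_mulVg : left_inverse GL_one GL_inv GL_mul.
Proof. by move=> x; apply: val_inj; rewrite /= mulVmx ?(valP x). Qed.
Fact GL_mulgV : right_inverse GL_one GL_inv GL_mul.
Proof. by move=> x; apply: val_inj; rewrite /= mulmxV ?(valP x). Qed.

HB.instance Definition _ := isGroup.Build (GL n F)
  GL_mulA GL_mul1g GL_mulg1 GL_mulVg GL_mulgV.
End GLGroup.

Section GLMap.
Variables (n : nat) (F L : fieldType) (f : {rmorphism F -> L}).

Fact GL_map_subproof (g : GL n F) : map_mx f (val g) \in unitmx.
Proof. by rewrite map_unitmx (valP g). Qed.
Definition GL_map (g : GL n F) : GL n L := exist (fun M => M \in unitmx) _ (GL_map_subproof g).

Fact GL_map1 : GL_map 1%g = 1%g.
Proof. by apply: val_inj; rewrite /= map_mx1. Qed.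
Fact GL_mapM g h : GL_map (g * h)%g = (GL_map g * GL_map h)%g.
Proof. by apply: val_inj; rewrite /= map_mxM. Qed.
Fact GL_mapV g : GL_map g^-1%g = (GL_map g)^-1%g.
Proof. by apply: val_inj; rewrite /= map_invmx. Qed.

Definition GL_preim (H : subgroup (GL n L)) : subgroup (GL n F).
Proof.
refine (@Subgroup (GL n F) (GL_map @^-1` H) _ _ _).
- by rewrite /= GL_map1; exact: sg1.
- by move=> x y; rewrite /= GL_mapM; exact: sgM.
- by move=> x; rewrite /= GL_mapV; exact: sgV.
Defined.
End GLMap.

(* Zeros in GL_n(L) of a set of polynomials over [F] in the matrix entries.
   As det is invertible on GL_n, allowing 1/det as a further variable gives the
   same closed sets. *)
Definition GL_zeros (n : nat) (F L : fieldType) (f : {rmorphism F -> L})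
    (S : set (mpoly.mpoly (n * n) F)) : set (GL n L) :=
  [set g | forall p, S p -> mpoly.mmap f (fun i => mxvec (val g) 0 i) p = 0].

Definition zariski_closed (n : nat) (L : fieldType) (A : set (GL n L)) : Prop :=
  exists S, A = GL_zeros (idfun : {rmorphism L -> L}) S.

Definition zariski_connected (n : nat) (L : fieldType) (A : set (GL n L)) :
    Prop :=
  forall B C, zariski_closed B -> zariski_closed C ->
    A = B `|` C -> B `&` C = set0 -> B = set0 \/ C = set0.

(* A linear algebraic group defined over the rationals is identified with its
   group of complex points. *)
Definition defined_over_rat (R : realType) (n : nat) (A : set (GL n R[i])) :
    Prop :=
  exists S, A = GL_zeros (ratr : {rmorphism rat -> R[i]}) S.

(* The radical, i.e. the largest connected solvable normal closed subgroup, is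
   trivial. *)
Definition semisimple (n : nat) (L : fieldType) (G : subgroup (GL n L)) :
    Prop :=
  forall N : subgroup (GL n L),
    zariski_closed N -> zariski_connected N -> normal_in N G ->
    solvable_set N -> N `<=` [set 1%g].

Section Points.
Variables (R : realType) (n : nat) (G : subgroup (GL n R[i])).

Definition real_points : subgroup (GL n R) :=
  GL_preim (real_complex R : {rmorphism R -> R[i]}) G.

Definition rat_points : subgroup (GL n rat) :=
  GL_preim (ratr : {rmorphism rat -> R[i]}) G.

Definition GLZ : set (GL n rat) :=
  [set g : GL n rat | forall i j, (val g i j \is a Num.int)
                    /\ (val (g^-1)%g i j \is a Num.int)].

Definition arithmetic (Gam : subgroup (GL n rat)) : Prop :=
  Gam `<=` rat_points /\ commensurable Gam (rat_points `&` GLZ).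

Fact rat_points_real (g : GL n rat) : sg_set rat_points g ->
  GL_map (ratr : {rmorphism rat -> R}) g \in sg_set real_points.
Proof.
rewrite inE /=; congr (sg_set G _); apply: val_inj; apply/matrixP=> i j.
by rewrite /= !mxE fmorph_rat.
Qed.
End Points.

Section GLTopology.
Variables (R : realType) (n : nat).
HB.instance Definition _ :=
  Topological.copy (GL n R) (initial_topology (val : GL n R -> 'M[R]_n)).
Variable H : subgroup (GL n R).
HB.instance Definition _ := Topological.copy (elt H) (set_type H).
End GLTopology.

Definition maximal_compact (R : realType) (n : nat) (H : subgroup (GL n R))
    (K : subgroup (elt H)) : Prop :=
  compact K /\
  forall K' : subgroup (elt H), compact K' -> K `<=` K' -> K' `<=` K.

Section Cosets.
Variables (G : groupType) (K : subgroup G).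

Definition lcoset_rel (x y : G) : bool := `[< sg_set K (x^-1 * y)%g >].

Fact lcoset_rel_equiv : equiv_class_of lcoset_rel.
Proof.
split=> [x|x y|y x z].
- by apply/asboolP; rewrite mulVg; exact: sg1.
- by apply/asboolP/asboolP => /sgV; rewrite invgM invgK.
- move=> /asboolP Kxy /asboolP Kyz; apply/asboolP.
  by have := sgM Kxy Kyz; rewrite mulgA mulgK.
Qed.
Canonical lcoset_equiv := EquivRelPack lcoset_rel_equiv.
End Cosets.

Section Homogeneous.
Variables (R : realType) (n : nat) (H : subgroup (GL n R)) (K : subgroup (elt H)).

Definition hspace : topologicalType := quotient_topology {eq_quot lcoset_rel K}.

Definition translate (g : elt H) (x : hspace) : hspace :=
  \pi_hspace (g * repr x)%g.

Fact translate_pi g h : translate g (\pi_hspace h) = \pi_hspace (g * h)%g.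
Proof.
apply/eqmodP/asboolP; rewrite invgM -mulgA mulKg.
by apply/asboolP; have /eqmodP := reprK (\pi_hspace h).
Qed.

Fact translate1 x : translate 1%g x = x.
Proof. by rewrite /translate mul1g reprK. Qed.
Fact translateM g h x : translate (g * h)%g x = translate g (translate h x).
Proof. by rewrite [translate h x]/translate translate_pi mulgA. Qed.
End Homogeneous.

Section Orbits.
Variables (G : groupType) (Y : topologicalType) (a : action G Y).

Definition orbit_rel (x y : Y) : bool := `[< exists g, y = a g x >].

Fact orbit_rel_equiv : equiv_class_of orbit_rel.
Proof.
split=> [x|x y|y x z].
- by apply/asboolP; exists 1%g; rewrite act1.
- by apply/asboolP/asboolP => -[g ->]; exists g^-1%g;
    rewrite -actM mulVg act1.
- move=> /asboolP[g ->] /asboolP[h ->]; apply/asboolP.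
  by exists (h * g)%g; rewrite actM.
Qed.
Canonical orbit_equiv := EquivRelPack orbit_rel_equiv.

Definition orbit_space : topologicalType := quotient_topology {eq_quot orbit_rel}.
End Orbits.

Definition action_invariant (G : groupType) (Y : Type) (a : action G Y) (S : set Y) :
  Prop := forall g y, S y -> S (a g y).

Section SubAction.
Variables (G : groupType) (Y : Type) (a : action G Y) (S : set Y).
Hypothesis Sinv : action_invariant a S.

Fact subact_subproof (g : G) (y : set_type S) : a g (val y) \in S.
Proof. by rewrite inE; apply: Sinv; apply: set_valP. Qed.
Definition subact (g : G) (y : set_type S) : set_type S :=
  exist (fun z => z \in S) _ (subact_subproof g y).

Fact subact1 y : subact 1%g y = y.
Proof. by apply: val_inj; rewrite /= act1. Qed.
Fact subactM g h y : subact (g * h)%g y = subact g (subact h y).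
Proof. by apply: val_inj; rewrite /= actM. Qed.

Definition sub_action : action G (set_type S) := Action subact1 subactM.
End SubAction.

Section ArithmeticAction.
Variables (R : realType) (n : nat) (G : subgroup (GL n R[i])).
Variables (K : subgroup (elt (real_points G))) (Gam : subgroup (GL n rat)).
Hypothesis GamG : Gam `<=` rat_points G.

Definition arith_incl (g : elt Gam) : elt (real_points G) :=
  exist (fun x => x \in sg_set (real_points G)) _
    (rat_points_real (GamG (set_valP g))).

Definition arith_act (g : elt Gam) (x : hspace K) : hspace K :=
  translate (arith_incl g) x.

Fact arith_act1 x : arith_act 1%g x = x.
Proof.
rewrite /arith_act (_ : arith_incl _ = 1%g) ?translate1 //.
by do 2 apply: val_inj; rewrite /= map_mx1.
Qed.
Fact arith_actM g h x : arith_act (g * h)%g x = arith_act g (arith_act h x).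
Proof.
rewrite /arith_act -translateM; congr translate.
by do 2 apply: val_inj; rewrite /= map_mxM.
Qed.

Definition arith_action : action (elt Gam) (hspace K) :=
  Action arith_act1 arith_actM.
End ArithmeticAction.

(* Only h(y, 1) = y is required on [S], not that the homotopy be stationary
   there. *)
Definition equivariant_deformation_retraction (R : realType) (G : groupType)
    (Y : topologicalType) (a : action G Y) (S : set Y) (h : Y * R -> Y) :
    Prop :=
  [/\ {within setT `*` `[0, 1], continuous h},
      forall y, h (y, 0) = y,
      forall y, S (h (y, 1)),
      forall y, S y -> h (y, 1) = y
    & forall g y t, 0 <= t <= 1 -> h (a g y, t) = a g (h (y, t))].

Section CW.
Variable R : realType.

Definition cball (m : nat) : set 'rV[R]_m :=
  [set v | \sum_(i < m) v 0 i ^+ 2 <= 1].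
Definition oball (m : nat) : set 'rV[R]_m :=
  [set v | \sum_(i < m) v 0 i ^+ 2 < 1].

(* [cw_continuous], [cw_inj] and [cw_open] together say that each characteristic
   map is continuous on the closed ball and restricts to a homeomorphism from the
   open ball onto the open cell. *)
Record cw_structure (Y : topologicalType) := CWStructure {
  cell : Type;
  cell_dim : cell -> nat;
  char_map : forall e : cell, 'rV[R]_(cell_dim e) -> Y;
  open_cell : cell -> set Y := fun e => @char_map e @` @oball (cell_dim e);
  cw_hausdorff : hausdorff_space Y;
  cw_partition : forall y, exists! e, open_cell e y;
  cw_continuous : forall e, {within @cball (cell_dim e), continuous (@char_map e)};
  cw_inj : forall e, set_inj (@oball (cell_dim e)) (@char_map e);
  cw_open : forall e (U : set 'rV[R]_(cell_dim e)), open U ->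
    exists2 V : set Y, open V &
      @char_map e @` (U `&` @oball (cell_dim e)) = V `&` open_cell e;
  cw_boundary : forall e, exists2 J : set cell, finite_set J &
    @char_map e @` (@cball (cell_dim e) `\` @oball (cell_dim e)) `<=`
      \bigcup_(c in [set c | J c /\ (cell_dim c < cell_dim e)%N]) open_cell c;
  cw_weak : forall A : set Y,
    (forall e, closed (A `&` @char_map e @` @cball (cell_dim e))) -> closed A }.

Definition is_cw_dim (Y : topologicalType) (c : cw_structure Y) (d : nat) :
    Prop :=
  (forall e : cell c, (cell_dim e <= d)%N) /\
  exists e : cell c, cell_dim e = d.

Definition stabilizers_fix_cells (Y : topologicalType) (c : cw_structure Y)
    (G : groupType) (a : action G Y) : Prop :=
  forall (e : cell c) (g : G), a g @` open_cell e = open_cell e ->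
    forall y, open_cell e y -> a g y = y.
End CW.

Section Modules.
Variable k : comNzRingType.

Record submod (M : lmodType k) := Submod {
  sm_set :> set M;
  sm0 : sm_set 0;
  smP : forall c x y, sm_set x -> sm_set y -> sm_set (c *: x + y) }.

Section SubQuotient.
Variables (M : lmodType k) (S : submod M).

Definition submod_type : Type := set_type S.
HB.instance Definition _ := SubChoice.copy submod_type (set_type S).

Fact submod_type_closed : submod_closed (fun x : M => x \in sm_set S).
Proof.
split; first by rewrite inE; exact: sm0.
by move=> c x y; rewrite !inE; exact: smP.
Qed.
HB.instance Definition _ := GRing.SubChoice_isSubLmodule.Build k M
  (fun x : M => x \in sm_set S) submod_type submod_type_closed.

Fact smD x y : sm_set S x -> sm_set S y -> sm_set S (x + y).
Proof. by move=> Sx Sy; rewrite -[x]scale1r; exact: smP. Qed.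
Fact smZ c x : sm_set S x -> sm_set S (c *: x).
Proof. by move=> Sx; rewrite -[_ *: _]addr0; apply: smP => //; exact: sm0. Qed.
Fact smN x : sm_set S x -> sm_set S (- x).
Proof. by rewrite -scaleN1r; exact: smZ. Qed.

Definition quot_rel (x y : M) : bool := `[< sm_set S (x - y) >].
Fact quot_rel_equiv : equiv_class_of quot_rel.
Proof.
split=> [x|x y|y x z].
- by apply/asboolP; rewrite subrr; exact: sm0.
- by apply/asboolP/asboolP => /smN; rewrite opprB.
- move=> /asboolP Sxy /asboolP Syz; apply/asboolP.
  by have := smD Sxy Syz; rewrite addrA subrK.
Qed.
Canonical quot_equiv := EquivRelPack quot_rel_equiv.

Definition quotmod : Type := {eq_quot quot_rel}.
HB.instance Definition _ := Choice.on quotmod.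
HB.instance Definition _ := EqQuotient.on quotmod.

Fact quotP (x y : M) :
  \pi_quotmod x = \pi_quotmod y <-> sm_set S (x - y).
Proof.
split=> [/eqmodP/asboolP//|Sxy]; exact/eqmodP/asboolP.
Qed.
Fact quot_repr (x : M) : sm_set S (repr (\pi_quotmod x) - x).
Proof. by apply/quotP; rewrite reprK. Qed.

Fact quot_elim (P : quotmod -> Prop) :
  (forall x, P (\pi_quotmod x)) -> forall u, P u.
Proof. by move=> Px u; rewrite -[u]reprK. Qed.

Definition quot_add (u v : quotmod) : quotmod := \pi_quotmod (repr u + repr v).
Definition quot_opp (u : quotmod) : quotmod := \pi_quotmod (- repr u).
Definition quot_scale (c : k) (u : quotmod) : quotmod :=
  \pi_quotmod (c *: repr u).

Fact quot_addE x y :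
  quot_add (\pi_quotmod x) (\pi_quotmod y) = \pi_quotmod (x + y).
Proof.
by apply/quotP; rewrite opprD addrACA; apply: smD; exact: quot_repr.
Qed.
Fact quot_oppE x : quot_opp (\pi_quotmod x) = \pi_quotmod (- x).
Proof. by apply/quotP; rewrite -opprD; apply: smN; exact: quot_repr. Qed.
Fact quot_scaleE c x :
  quot_scale c (\pi_quotmod x) = \pi_quotmod (c *: x).
Proof. by apply/quotP; rewrite -scalerBr; apply: smZ; exact: quot_repr. Qed.

Fact quot_addA : associative quot_add.
Proof.
by elim/quot_elim=> x; elim/quot_elim=> y; elim/quot_elim=> z; rewrite !quot_addE addrA.
Qed.
Fact quot_addC : commutative quot_add.
Proof. by elim/quot_elim=> x; elim/quot_elim=> y; rewrite !quot_addE addrC. Qed.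
Fact quot_add0 : left_id (\pi_quotmod 0) quot_add.
Proof. by elim/quot_elim=> x; rewrite quot_addE add0r. Qed.
Fact quot_addN : left_inverse (\pi_quotmod 0) quot_opp quot_add.
Proof. by elim/quot_elim=> x; rewrite quot_oppE quot_addE addNr. Qed.
HB.instance Definition _ := GRing.isZmodule.Build quotmod
  quot_addA quot_addC quot_add0 quot_addN.

Fact quot_scaleA c d u : quot_scale c (quot_scale d u) = quot_scale (c * d) u.
Proof. by elim/quot_elim: u => x; rewrite !quot_scaleE scalerA. Qed.
Fact quot_scale1 : left_id 1 quot_scale.
Proof. by move=> u; elim/quot_elim: u => x; rewrite quot_scaleE scale1r. Qed.
Fact quot_scaleDr : right_distributive quot_scale +%R.
Proof.
move=> c u v; elim/quot_elim: u => x; elim/quot_elim: v => y.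
by rewrite [LHS](congr1 (quot_scale c) (quot_addE x y)) quot_scaleE scalerDr
  -quot_addE -!quot_scaleE.
Qed.
Fact quot_scaleDl u : {morph quot_scale^~ u : c d / c + d}.
Proof.
by move=> c d; elim/quot_elim: u => x; rewrite quot_scaleE scalerDl
  -quot_addE -!quot_scaleE.
Qed.
HB.instance Definition _ := GRing.Zmodule_isLmodule.Build k quotmod
  quot_scaleA quot_scale1 quot_scaleDr quot_scaleDl.

Definition quot_pi (x : M) : quotmod := \pi_quotmod x.
Fact quot_pi_linear : linear quot_pi.
Proof. by move=> c x y; rewrite /quot_pi -quot_addE -quot_scaleE. Qed.
HB.instance Definition _ :=
  GRing.isLinear.Build k M quotmod *:%R quot_pi quot_pi_linear.
End SubQuotient.

Section InducedMaps.
Variables (M N : lmodType k) (f : {linear M -> N}).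
Variables (S : submod M) (T : submod N).
Hypothesis fST : forall x, sm_set S x -> sm_set T (f x).

#[using="fST"]
Definition quot_map (u : quotmod S) : quotmod T := quot_pi T (f (repr u)).
Fact quot_mapE x : quot_map (quot_pi S x) = quot_pi T (f x).
Proof. by apply/quotP; rewrite -raddfB; apply: fST; exact: quot_repr. Qed.
Fact quot_map_linear : linear quot_map.
Proof.
move=> c u v; elim/quot_elim: u => x; elim/quot_elim: v => y.
rewrite -![\pi_(quotmod S) _]/(quot_pi S _) -linearP !quot_mapE.
by rewrite !linearP.
Qed.
HB.instance Definition _ :=
  GRing.isLinear.Build k (quotmod S) (quotmod T) *:%R quot_map quot_map_linear.

Fact sub_map_subproof (x : submod_type S) : f (val x) \in sm_set T.
Proof. by rewrite inE; apply: fST; exact: set_valP. Qed.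
Definition sub_map (x : submod_type S) : submod_type T :=
  exist (fun y => y \in sm_set T) _ (sub_map_subproof x).
Fact sub_map_linear : linear sub_map.
Proof. by move=> c x y; apply: val_inj; rewrite /= !linearP. Qed.
HB.instance Definition _ := GRing.isLinear.Build k (submod_type S)
  (submod_type T) *:%R sub_map sub_map_linear.
End InducedMaps.

Section KerIm.
Variables (M N : lmodType k) (f : {linear M -> N}).

Definition ker_submod : submod M.
Proof.
refine (@Submod M [set x | f x = 0] _ _); first by rewrite /= raddf0.
by move=> c x y /= fx fy; rewrite linearP fx fy scaler0 addr0.
Defined.

Definition im_submod : submod N.
Proof.
refine (@Submod N (range f) _ _); first by exists 0; rewrite ?raddf0.
by move=> c _ _ [x _ <-] [y _ <-]; exists (c *: x + y); rewrite ?linearP.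
Defined.

Definition preim_submod (S : submod N) : submod M.
Proof.
refine (@Submod M (f @^-1` S) _ _); first by rewrite /= raddf0; exact: sm0.
by move=> c x y; rewrite /= linearP; exact: smP.
Defined.
End KerIm.

Definition zero_submod (M : lmodType k) : submod M :=
  ker_submod (idfun : {linear M -> M}).

(* The subquotient Z / (B /\ Z). *)
Definition subquot (M : lmodType k) (Z B : submod M) : lmodType k :=
  quotmod (preim_submod (val : {linear submod_type Z -> M}) B).

Section DependentProduct.
Variables (I : Type) (M : I -> lmodType k).

Definition dprod : Type := forall i, M i.
HB.instance Definition _ := Choice.copy dprod (forall i, M i).

Definition dprod_add (s t : dprod) : dprod := fun i => s i + t i.
Definition dprod_opp (s : dprod) : dprod := fun i => - s i.
Definition dprod_zero : dprod := fun i => 0.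
Definition dprod_scale (c : k) (s : dprod) : dprod := fun i => c *: s i.

Fact dprod_addA : associative dprod_add.
Proof. by move=> s t u; apply: functional_extensionality_dep=> i; exact: addrA. Qed.
Fact dprod_addC : commutative dprod_add.
Proof. by move=> s t; apply: functional_extensionality_dep=> i; exact: addrC. Qed.
Fact dprod_add0 : left_id dprod_zero dprod_add.
Proof. by move=> s; apply: functional_extensionality_dep=> i; exact: add0r. Qed.
Fact dprod_addN : left_inverse dprod_zero dprod_opp dprod_add.
Proof. by move=> s; apply: functional_extensionality_dep=> i; exact: addNr. Qed.
HB.instance Definition _ := GRing.isZmodule.Build dprod
  dprod_addA dprod_addC dprod_add0 dprod_addN.

Fact dprod_scaleA c d s : dprod_scale c (dprod_scale d s) = dprod_scale (c * d) s.
Proof. by apply: functional_extensionality_dep=> i; exact: scalerA. Qed.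
Fact dprod_scale1 : left_id 1 dprod_scale.
Proof. by move=> s; apply: functional_extensionality_dep=> i; exact: scale1r. Qed.
Fact dprod_scaleDr : right_distributive dprod_scale +%R.
Proof.
by move=> c s t; apply: functional_extensionality_dep=> i; exact: scalerDr.
Qed.
Fact dprod_scaleDl s : {morph dprod_scale^~ s : c d / c + d}.
Proof.
by move=> c d; apply: functional_extensionality_dep=> i; exact: scalerDl.
Qed.
HB.instance Definition _ := GRing.Zmodule_isLmodule.Build k dprod
  dprod_scaleA dprod_scale1 dprod_scaleDr dprod_scaleDl.
End DependentProduct.
End Modules.

Record opens (X : topologicalType) := Opens {
  oset :> set X;
  osetP : open oset }.

Definition opens_full (X : topologicalType) : opens X := Opens (@openT X).
Definition opens_meet (X : topologicalType) (U V : opens X) : opens X :=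
  Opens (openI (osetP U) (osetP V)).
Fact opens_meetl (X : topologicalType) (U V : opens X) : opens_meet U V `<=` U.
Proof. by move=> y []. Qed.
Fact opens_meetr (X : topologicalType) (U V : opens X) : opens_meet U V `<=` V.
Proof. by move=> y []. Qed.

Definition set_incl (T : Type) (V U : set T) (VU : V `<=` U) (x : set_type V) :
    set_type U :=
  exist (fun y => y \in U) (val x) (mem_set (VU _ (set_valP x))).

Record presheaf (k : comNzRingType) (X : topologicalType) := Presheaf {
  sec : opens X -> lmodType k;
  res : forall U V : opens X, V `<=` U -> {linear sec U -> sec V};
  res_id : forall (U : opens X) (UU : U `<=` U) (s : sec U), res UU s = s;
  res_comp : forall (U V W : opens X) (VU : V `<=` U) (WV : W `<=` V)
    (WU : W `<=` U) (s : sec U), res WV (res VU s) = res WU s }.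

Arguments res {k X p U V}.
Arguments res_id {k X p U}.
Arguments res_comp {k X p U V W}.

Section Stalks.
Variables (k : comNzRingType) (X : topologicalType) (F : presheaf k X) (x : X).

Record local_sec := LocalSec {
  ls_open : opens X;
  ls_mem : oset ls_open x;
  ls_sec : sec F ls_open }.
HB.instance Definition _ := gen_eqMixin local_sec.
HB.instance Definition _ := gen_choiceMixin local_sec.

Definition germ_rel (s t : local_sec) : bool :=
  `[< exists (W : opens X) (Ws : W `<=` ls_open s) (Wt : W `<=` ls_open t),
        oset W x /\ res Ws (ls_sec s) = res Wt (ls_sec t) >].

Fact germ_rel_equiv : equiv_class_of germ_rel.
Proof.
split=> [s|s t|t s u].
- apply/asboolP; exists (ls_open s), (fun=> id), (fun=> id).
  by split=> //; exact: ls_mem.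
- by apply/asboolP/asboolP => -[W [Ws [Wt [Wx e]]]]; exists W, Wt, Ws.
- move=> /asboolP[V [Vs [Vt [Vx eV]]]] /asboolP[W [Wt [Wu [Wx eW]]]].
  apply/asboolP; exists (opens_meet V W).
  have VWV : opens_meet V W `<=` V by move=> y [].
  have VWW : opens_meet V W `<=` W by move=> y [].
  exists (subset_trans VWV Vs), (subset_trans VWW Wu); split; first by split.
  rewrite -(res_comp Vs VWV) eV -(res_comp Wu VWW) -eW.
  rewrite (res_comp Vt VWV (subset_trans VWW Wt));
    exact/esym/res_comp.
Qed.
Canonical germ_equiv := EquivRelPack germ_rel_equiv.

Definition stalk : Type := {eq_quot germ_rel}.
HB.instance Definition _ := Choice.on stalk.
HB.instance Definition _ := EqQuotient.on stalk.

Definition germ (U : opens X) (Ux : oset U x) (s : sec F U) : stalk :=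
  \pi_stalk (LocalSec Ux s).

Fact germ_eqP (U V : opens X) (Ux : oset U x) (Vx : oset V x) s t :
  germ Ux s = germ Vx t <->
  exists (W : opens X) (WU : W `<=` U) (WV : W `<=` V),
    oset W x /\ res WU s = res WV t.
Proof. by split=> [/eqmodP/asboolP//|st]; apply/eqmodP/asboolP. Qed.

Fact germ_res (U V : opens X) (Ux : oset U x) (Vx : oset V x) (VU : V `<=` U) s :
  germ Vx (res VU s) = germ Ux s.
Proof.
apply/germ_eqP; exists V, (fun=> id), VU; split=> //; exact: res_id.
Qed.

Fact germ_elim (P : stalk -> Prop) :
  (forall (U : opens X) (Ux : oset U x) s, P (germ Ux s)) -> forall u, P u.
Proof.
by move=> Ps u; rewrite -[u]reprK; case: (repr u) => U Ux s; exact: Ps.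
Qed.

Fact germ_elim2 (P : stalk -> stalk -> Prop) :
  (forall (U : opens X) (Ux : oset U x) s t, P (germ Ux s) (germ Ux t)) ->
  forall u v, P u v.
Proof.
move=> Pst u v; elim/germ_elim: u => U Ux s; elim/germ_elim: v => V Vx t.
have sU : opens_meet U V `<=` U by move=> y [].
have sV : opens_meet U V `<=` V by move=> y [].
have UVx : oset (opens_meet U V) x by split.
by rewrite -(germ_res Ux UVx sU) -(germ_res Vx UVx sV).
Qed.

Fact germ_elim3 (P : stalk -> stalk -> stalk -> Prop) :
  (forall (U : opens X) (Ux : oset U x) s t r,
     P (germ Ux s) (germ Ux t) (germ Ux r)) ->
  forall u v w, P u v w.
Proof.
move=> Pst u v w; elim/germ_elim: w => V Vx r; move: u v; apply: germ_elim2 => U Ux s t.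
have sU : opens_meet U V `<=` U by move=> y [].
have sV : opens_meet U V `<=` V by move=> y [].
have UVx : oset (opens_meet U V) x by split.
by rewrite -!(germ_res Ux UVx sU) -(germ_res Vx UVx sV).
Qed.

Definition stalk_add (u v : stalk) : stalk :=
  let s := repr u in let t := repr v in
  @germ (opens_meet (ls_open s) (ls_open t)) (conj (ls_mem s) (ls_mem t))
    (res (@opens_meetl _ _ _) (ls_sec s) + res (@opens_meetr _ _ _) (ls_sec t)).
Definition stalk_opp (u : stalk) : stalk :=
  germ (ls_mem (repr u)) (- ls_sec (repr u)).
Definition stalk_scale (c : k) (u : stalk) : stalk :=
  germ (ls_mem (repr u)) (c *: ls_sec (repr u)).
Definition stalk_zero : stalk := @germ (opens_full X) I 0.

Fact germ_repr (U : opens X) (Ux : oset U x) (s : sec F U) :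
  exists (W : opens X) (WU : W `<=` U) (Wr : W `<=` ls_open (repr (germ Ux s))),
    oset W x /\ res WU s = res Wr (ls_sec (repr (germ Ux s))).
Proof.
apply/(germ_eqP Ux (ls_mem (repr (germ Ux s)))).
by rewrite -[LHS]reprK; congr \pi; case: (repr _).
Qed.

Fact stalk_addE (U : opens X) (Ux : oset U x) s t :
  stalk_add (germ Ux s) (germ Ux t) = germ Ux (s + t).
Proof.
have [V [VU [Vs [Vx es]]]] := germ_repr Ux s.
have [W [WU [Wt [Wx et]]]] := germ_repr Ux t.
have sV : opens_meet V W `<=` V by move=> y [].
have sW : opens_meet V W `<=` W by move=> y [].
apply/germ_eqP; exists (opens_meet V W).
exists (fun y h => conj (Vs y (sV y h)) (Wt y (sW y h))).
exists (subset_trans sV VU); split; first by split.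
rewrite !linearD /= !(res_comp _ _ (subset_trans sV Vs)).
rewrite -(res_comp Vs sV) -es (res_comp VU sV (subset_trans sV VU)); congr +%R.
rewrite (res_comp _ _ (subset_trans sW Wt)) -(res_comp Wt sW) -et.
exact: res_comp.
Qed.

Fact stalk_oppE (U : opens X) (Ux : oset U x) s :
  stalk_opp (germ Ux s) = germ Ux (- s).
Proof.
have [V [VU [Vs [Vx es]]]] := germ_repr Ux s.
by apply/germ_eqP; exists V, Vs, VU; split=> //; rewrite !linearN /= es.
Qed.

Fact stalk_scaleE c (U : opens X) (Ux : oset U x) s :
  stalk_scale c (germ Ux s) = germ Ux (c *: s).
Proof.
have [V [VU [Vs [Vx es]]]] := germ_repr Ux s.
by apply/germ_eqP; exists V, Vs, VU; split=> //; rewrite !linearZ /= es.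
Qed.

Fact stalk_zeroE (U : opens X) (Ux : oset U x) : stalk_zero = germ Ux 0.
Proof.
by apply/germ_eqP; exists U, (fun _ _ => I), (fun=> id); rewrite !linear0.
Qed.

Fact stalk_addA : associative stalk_add.
Proof.
by move=> u v w; move: u v w; apply: germ_elim3 => U Ux s t r;
  rewrite !stalk_addE addrA.
Qed.
Fact stalk_addC : commutative stalk_add.
Proof.
by move=> u v; move: u v; apply: germ_elim2 => U Ux s t; rewrite !stalk_addE addrC.
Qed.
Fact stalk_add0 : left_id stalk_zero stalk_add.
Proof.
by move=> u; elim/germ_elim: u => U Ux s;
  rewrite (stalk_zeroE Ux) stalk_addE add0r.
Qed.
Fact stalk_addN : left_inverse stalk_zero stalk_opp stalk_add.
Proof.
by move=> u; elim/germ_elim: u => U Ux s;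
  rewrite (stalk_zeroE Ux) stalk_oppE stalk_addE addNr.
Qed.
HB.instance Definition _ := GRing.isZmodule.Build stalk
  stalk_addA stalk_addC stalk_add0 stalk_addN.

Fact stalk_scaleA c d u :
  stalk_scale c (stalk_scale d u) = stalk_scale (c * d) u.
Proof. by elim/germ_elim: u => U Ux s; rewrite !stalk_scaleE scalerA. Qed.
Fact stalk_scale1 : left_id 1 stalk_scale.
Proof.
by move=> u; elim/germ_elim: u => U Ux s; rewrite stalk_scaleE scale1r.
Qed.
Fact stalk_scaleDr : right_distributive stalk_scale +%R.
Proof.
move=> c u v; move: u v; apply: germ_elim2 => U Ux s t.
by rewrite [LHS](congr1 (stalk_scale c) (stalk_addE Ux s t)) !stalk_scaleE
  scalerDr -stalk_addE.
Qed.
Fact stalk_scaleDl u : {morph stalk_scale^~ u : c d / c + d}.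
Proof.
move=> c d; elim/germ_elim: u => U Ux s.
by rewrite !stalk_scaleE scalerDl -stalk_addE.
Qed.
HB.instance Definition _ := GRing.Zmodule_isLmodule.Build k stalk
  stalk_scaleA stalk_scale1 stalk_scaleDr stalk_scaleDl.

Fact germ_linear (U : opens X) (Ux : oset U x) : linear (germ Ux).
Proof.
by move=> c s t; rewrite -stalk_addE -stalk_scaleE.
Qed.
End Stalks.

Section Godement.
Variables (k : comNzRingType) (X : topologicalType).

Definition dres (F : presheaf k X) (U V : opens X) (VU : V `<=` U)
    (s : dprod (fun x : set_type U => stalk F (val x))) :
    dprod (fun x : set_type V => stalk F (val x)) :=
  fun x => s (set_incl VU x).

Fact dres_linear F (U V : opens X) (VU : V `<=` U) : linear (@dres F U V VU).
Proof. by []. Qed.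
HB.instance Definition _ F (U V : opens X) (VU : V `<=` U) :=
  GRing.isLinear.Build k _ _ *:%R (@dres F U V VU) (dres_linear VU).

Fact dres_id F (U : opens X) (UU : U `<=` U)
    (s : dprod (fun x : set_type U => stalk F (val x))) :
  dres UU s = s.
Proof.
apply: functional_extensionality_dep => -[x xU]; rewrite /dres /set_incl /=.
by rewrite (bool_irrelevance (mem_set _) xU).
Qed.

Fact dres_comp F (U V W : opens X) (VU : V `<=` U) (WV : W `<=` V)
    (WU : W `<=` U) (s : dprod (fun x : set_type U => stalk F (val x))) :
  dres WV (dres VU s) = dres WU s.
Proof.
apply: functional_extensionality_dep => -[x xW]; rewrite /dres /set_incl /=.
by congr (s (exist _ _ _)); exact: bool_irrelevance.
Qed.

Definition godement (F : presheaf k X) : presheaf k X :=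
  @Presheaf k X (fun U => dprod (fun x : set_type U => stalk F (val x)))
    (fun U V VU => @dres F U V VU) (@dres_id F) (@dres_comp F).

Definition godement_unit (F : presheaf k X) (U : opens X) (s : sec F U) :
  sec (godement F) U := fun x => germ (set_valP x) s.
Fact godement_unit_linear F U : linear (@godement_unit F U).
Proof.
move=> c s t; apply: functional_extensionality_dep => x; exact: germ_linear.
Qed.
HB.instance Definition _ F U :=
  GRing.isLinear.Build k _ _ *:%R (@godement_unit F U)
    (@godement_unit_linear F U).

Fact godement_unit_res F (U V : opens X) (VU : V `<=` U) (s : sec F U) :
  res VU (godement_unit s) = godement_unit (res VU s).
Proof.
by apply: functional_extensionality_dep => x; exact/esym/germ_res.
Qed.

Definition sheafify_sec (F : presheaf k X) (U : opens X) :
  submod (sec (godement F) U).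
Proof.
refine (@Submod _ _ [set s | forall x : set_type U,
  exists (V : opens X) (VU : V `<=` U) (t : sec F V),
    oset V (val x) /\ res VU s = godement_unit t] _ _).
- move=> x; exists U, (fun=> id), 0; split; first exact: set_valP.
  by rewrite !linear0.
- move=> c s s' Ps Ps' x.
  have [V [VU [t [Vx e]]]] := Ps x; have [W [WU [t' [Wx e']]]] := Ps' x.
  exists (opens_meet V W), (subset_trans (@opens_meetl _ V W) VU).
  exists (c *: res (@opens_meetl _ V W) t + res (@opens_meetr _ V W) t').
  split; first by split.
  rewrite !linearP /= -!godement_unit_res -e -e'; congr (_ *: _ + _).
    exact: (esym (dres_comp VU (@opens_meetl _ V W) _ s)).
  exact: (esym (dres_comp WU (@opens_meetr _ V W) _ s')).
Defined.

Fact sheafify_res_subproof F (U V : opens X) (VU : V `<=` U) s :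
  sm_set (sheafify_sec F U) s -> sm_set (sheafify_sec F V) (res VU s).
Proof.
move=> Ps x; have [W [WU [t [Wx e]]]] := Ps (set_incl VU x).
exists (opens_meet V W), (@opens_meetl _ V W), (res (@opens_meetr _ V W) t).
split; first by split=> //; exact: set_valP.
rewrite -godement_unit_res -e.
rewrite (res_comp _ _ (subset_trans (@opens_meetl _ V W) VU)).
exact/esym/res_comp.
Qed.

Definition sheafify (F : presheaf k X) : presheaf k X.
Proof.
refine (@Presheaf k X (fun U => submod_type (sheafify_sec F U))
  (fun U V VU => sub_map (sheafify_res_subproof VU)) _ _).
- by move=> U UU s; apply: val_inj; exact: (@res_id _ _ (godement F)).
- by move=> U V W VU WV WU s; apply: val_inj; exact: (@res_comp _ _ (godement F)).
Defined.

Fact godement_im_res (F : presheaf k X) (U V : opens X) (VU : V `<=` U) s :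
  sm_set (im_submod (@godement_unit F U)) s ->
  sm_set (im_submod (@godement_unit F V)) (res VU s).
Proof.
by move=> [t _ <-]; exists (res VU t); rewrite ?godement_unit_res.
Qed.

(* Presheaf cokernel of F -> godement F.  It is not sheafified: only its stalks
   are used below, and these are the stalks of the quotient sheaf. *)
Definition godement_coker (F : presheaf k X) : presheaf k X.
Proof.
refine (@Presheaf k X (fun U => quotmod (im_submod (@godement_unit F U)))
  (fun U V VU => quot_map (@godement_im_res F U V VU)) _ _).
- move=> U UU s; elim/quot_elim: s => s.
  by rewrite [LHS]quot_mapE; congr quot_pi; exact: res_id.
- move=> U V W VU WV WU s; elim/quot_elim: s => s.
  rewrite -[\pi_(quotmod _) s]/(quot_pi _ s) /= !quot_mapE.
  by congr quot_pi; exact: (@res_comp _ _ (godement F)).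
Defined.

(* Godement's canonical resolution
     0 -> F -> C^0 -> C^1 -> ...,  C^n = godement (godement_syz n),
   whose terms are flasque; the differential is the composite
   C^n -> godement_syz n.+1 -> C^n.+1. *)
Variable F : presheaf k X.

Fixpoint godement_syz (n : nat) : presheaf k X :=
  if n is m.+1 then godement_coker (godement_syz m) else F.

Definition godement_cochain (n : nat) : lmodType k :=
  sec (godement (godement_syz n)) (opens_full X).

Definition godement_diff (n : nat) :
    {linear godement_cochain n -> godement_cochain n.+1} :=
  (@godement_unit (godement_syz n.+1) (opens_full X)
     \o quot_pi (im_submod (@godement_unit (godement_syz n) (opens_full X))))%FUN.

Definition godement_cobound (n : nat) : submod (godement_cochain n) :=
  match n with
  | 0 => zero_submod (godement_cochain 0)
  | m.+1 => im_submod (godement_diff m)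
  end.

Definition sheaf_cohomology (n : nat) : lmodType k :=
  subquot (ker_submod (godement_diff n)) (godement_cobound n).
End Godement.

Record representation (k : comNzRingType) (G : groupType) (E : lmodType k) :=
  Representation {
    rep :> G -> {linear E -> E};
    rep1 : forall x, rep 1%g x = x;
    repM : forall g h x, rep (g * h)%g x = rep g (rep h x) }.

Section EquivariantSheaf.
Variables (k : comNzRingType) (G : groupType) (Y : topologicalType).
Variables (a : action G Y) (E : lmodType k) (rho : representation G E).

Definition orbit_preim (U : set (orbit_space a)) : set Y :=
  \pi_(orbit_space a) @^-1` U.

Definition locally_constant (T : topologicalType) (f : T -> E) : Prop :=
  forall x, \forall y \near x, f y = f x.

Definition equivariant_sec (U : opens (orbit_space a)) :
  submod (set_type (orbit_preim U) -> E).
Proof.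
refine (@Submod _ _ [set f | locally_constant f /\
  forall (g : G) (x y : set_type (orbit_preim U)),
    val y = a g (val x) -> f y = rho g (f x)] _ _).
- by split=> [x|g x y _]; [exact: filterE | exact: (esym (linear0 (rho g)))].
- move=> c f f' [lf ef] [lf' ef']; split=> [x|g x y yx].
    by near=> y; congr (_ *: _ + _); near: y; [exact: lf | exact: lf'].
  by rewrite linearP /= -(ef _ _ _ yx) -(ef' _ _ _ yx).
Unshelve. all: by end_near.
Defined.

Section Restriction.
Variables (U V : opens (orbit_space a)) (VU : V `<=` U).

Fact orbit_preim_subset : orbit_preim V `<=` orbit_preim U.
Proof. by move=> y; apply: VU. Qed.

Definition fun_res (f : set_type (orbit_preim U) -> E) :
  set_type (orbit_preim V) -> E := fun x => f (set_incl orbit_preim_subset x).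
Fact fun_res_linear : linear fun_res.
Proof. by []. Qed.
HB.instance Definition _ :=
  GRing.isLinear.Build k _ _ *:%R fun_res fun_res_linear.

Fact fun_res_subproof f :
  sm_set (equivariant_sec U) f -> sm_set (equivariant_sec V) (fun_res f).
Proof.
move=> [lf ef]; split=> [x|g x y yx]; last exact: ef.
have ci : continuous (set_incl orbit_preim_subset).
  apply: continuous_comp_initial => /=.
  exact: initial_continuous.
exact: (ci x _ (lf (set_incl orbit_preim_subset x))).
Qed.
End Restriction.

Definition equivariant_presheaf : presheaf k (orbit_space a).
Proof.
refine (@Presheaf k (orbit_space a)
  (fun U => submod_type (equivariant_sec U))
  (fun U V VU => sub_map (@fun_res_subproof U V VU)) _ _).
- move=> U UU s; apply: val_inj; apply: functional_extensionality_dep => x.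
  by congr (val s _); apply: val_inj.
- move=> U V W VU WV WU s; apply: val_inj.
  apply: functional_extensionality_dep => x.
  by congr (val s _); apply: val_inj.
Defined.

Definition equivariant_sheaf : presheaf k (orbit_space a) :=
  sheafify equivariant_presheaf.
End EquivariantSheaf.

(* Main.v *)
Require Import Defs.
From HB Require Import structures.
From mathcomp Require Import all_boot all_order all_algebra.
From mathcomp Require Import all_classical all_reals topology.
From mathcomp Require Import normedtype.
From mathcomp.real_closed Require Import complex.

Set Implicit Arguments.
Unset Strict Implicit.
Unset Printing Implicit Defensive.
Import Order.TTheory GRing.Theory Num.Theory numFieldNormedType.Exports.

Local Open Scope classical_set_scope.
Local Open Scope quotient_scope.
Local Open Scope ring_scope.

(* Only the equivariant deformation retraction and the continuity of the action
   matter.  A continuous equivariant map pulls locally constant equivariant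
   functions back, hence acts on stalks, on Godement resolutions and on
   cohomology; so it suffices to show that the ends y |-> (y, 0) and
   y |-> (y, 1) of the cylinder D x [0, 1] induce the same map in cohomology,
   since the homotopy composed with them gives the identity and the retraction.

   A cochain of the Godement resolution is a family c of germs, one at each
   point, and it is a cocycle iff c is locally given by a section (reg_at).  Let
   p be the projection of the orbit space of the cylinder onto that of D, and
   i0 the section at height 0.  A cocycle c differs from p^* i0^* c by a cocycle
   with zero pull-back along i0, and such a cocycle is a coboundary: along one
   fibre of p, primitives are glued step by step, because their differences
   extend along the whole fibre (this uses that the sheaf is constant along
   fibres in degree 0, and that every germ of a syzygy comes from a global
   cochain in higher degrees); compactness of [0, 1] gives a primitive over an
   open tube; and tubes are glued by Zorn's lemma, because by induction on the
   degree cocycles with zero pull-back along i0 extend from a tube to the whole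
   cylinder. *)

(** * Discontinuous sections and the Godement differential *)

Lemma quot_pi_eq0 (k : comNzRingType) (M : lmodType k) (S : submod M) (x : M) :
  quot_pi S x = 0 <-> sm_set S x.
Proof.
have := Defs.quotP S x 0; rewrite subr0 => <-.
by rewrite -[\pi_(quotmod S) 0]/(quot_pi S 0) linear0.
Qed.

Section DiscontinuousSections.
Variables (k : comNzRingType) (X : topologicalType).
Implicit Types (Z : presheaf k X) (x : X).

(** Indexing by the points of X, instead of by the subtype of the full open set as in
    [godement_cochain], keeps membership proofs out of the computations. *)
Definition dsec Z : lmodType k := dprod (fun x : X => stalk Z x).

Lemma opens_nbhs (W : opens X) x : oset W x -> nbhs x W.
Proof. by move=> Wx; apply: open_nbhs_nbhs; split=> //; exact: osetP. Qed.

Lemma nbhs_opens x (A : set X) :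
  nbhs x A -> exists2 W : opens X, oset W x & oset W `<=` A.
Proof. by rewrite nbhsE => -[B [oB Bx] BA]; exists (Opens oB). Qed.

Definition reg_at Z (c : dsec Z) x : Prop :=
  exists (W : opens X) (s : sec Z W), oset W x /\
    forall w (Ww : oset W w), c w = germ Ww s.

Lemma reg_at0 Z x : reg_at (0 : dsec Z) x.
Proof. by exists (opens_full X), 0; split=> // w Ww; rewrite -stalk_zeroE. Qed.

Lemma reg_atP Z (a : k) (c c' : dsec Z) x :
  reg_at c x -> reg_at c' x -> reg_at (a *: c + c') x.
Proof.
move=> [W [s [Wx cs]]] [W' [s' [W'x cs']]].
exists (opens_meet W W').
exists (a *: res (@opens_meetl _ W W') s + res (@opens_meetr _ W W') s').
split=> // w Ww; have [Ww1 Ww2] := Ww.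
rewrite germ_linear !(germ_res Ww1, germ_res Ww2).
by rewrite -cs -cs'.
Qed.

Lemma reg_atB Z (c c' : dsec Z) x :
  reg_at c x -> reg_at c' x -> reg_at (c - c') x.
Proof. by rewrite addrC -scaleN1r => rc rc'; exact: reg_atP. Qed.

Lemma reg_at_near_eq Z (c c' : dsec Z) x :
  reg_at c x -> (\forall w \near x, c w = c' w) -> reg_at c' x.
Proof.
move=> [W [s [Wx cs]]] /nbhs_opens[V Vx Vc].
exists (opens_meet W V), (res (@opens_meetl _ W V) s); split=> [|w Ww]; first by split.
have [Ww1 Ww2] := Ww.
by rewrite -Vc // cs (germ_res Ww1).
Qed.

(** Equality of two germs at [x] is equality of sections on a neighbourhood, so pointwise identities
    between regular cochains spread out. *)
Lemma reg_at_agree Z (c c' : dsec Z) x :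
  reg_at c x -> reg_at c' x -> c x = c' x -> \forall w \near x, c w = c' w.
Proof.
move=> [W [s [Wx cs]]] [W' [s' [W'x cs']]].
rewrite (cs _ Wx) (cs' _ W'x) => /germ_eqP[V [VW [VW' [Vx e]]]].
apply: filterS (opens_nbhs Vx) => w Vw.
rewrite (cs _ (VW _ Vw)) (cs' _ (VW' _ Vw)).
by rewrite -(germ_res (VW _ Vw) Vw VW) e (germ_res (VW' _ Vw)).
Qed.

Lemma reg_at_germ Z x (u : stalk Z x) : exists2 c : dsec Z, reg_at c x & c x = u.
Proof.
elim/germ_elim: u => U Ux s.
(* Outside [U] the value is arbitrary, since regularity is tested only near [x]. *)
exists (fun w => if pselect (oset U w) is left Uw then germ Uw s else 0).
  exists U, s; split=> // w Uw; case: pselect => // Uw'.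
  by rewrite (Prop_irrelevance Uw' Uw).
by case: pselect => // Ux'; rewrite (Prop_irrelevance Ux' Ux).
Qed.

Lemma godement_unitE Z (U : opens X) (s : sec Z U) (w : X)
  (Uw : oset U w) (wU : w \in oset U) :
  godement_unit s (exist (fun z => z \in oset U) w wU) = germ Uw s.
Proof. by rewrite (Prop_irrelevance Uw (set_valP (exist _ w wU))). Qed.

Definition full_sec Z (c : dsec Z) : sec (godement Z) (opens_full X) :=
  fun x : set_type (opens_full X) => c (val x).

(* The Godement differential, computed germ by germ. *)
Definition delta Z (c : dsec Z) : dsec (godement_coker Z) :=
  fun x => @germ _ _ (godement_coker Z) x (opens_full X) I
    (quot_pi _ (full_sec c)).

Lemma delta_linear Z : linear (@delta Z).
Proof.
move=> a c c'; apply: functional_extensionality_dep => x.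
by rewrite /delta (_ : full_sec _ = a *: full_sec c + full_sec c') // linearP
  germ_linear.
Qed.
HB.instance Definition _ Z :=
  GRing.isLinear.Build k _ _ *:%R (@delta Z) (@delta_linear Z).

(** A class in the presheaf cokernel has zero germ exactly when its representative becomes, on a
    smaller open set, the family of germs of one section. *)
Lemma delta_eq0 Z (c : dsec Z) x : delta c x = 0 <-> reg_at c x.
Proof.
rewrite -[0]/(stalk_zero _ _) (stalk_zeroE _ (I : oset (opens_full X) x)).
split=> [/germ_eqP[W [WU [WV [Wx]]]]|[W [s [Wx cs]]]].
  rewrite linear0 /= quot_mapE => /quot_pi_eq0[s _ e].
  exists W, s; split=> // w Ww.
  have := congr1 (fun t : dprod _ => t (exist _ w (mem_set Ww))) e.
  by rewrite /= (godement_unitE s Ww) => ->.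
apply/germ_eqP; exists W, (fun _ _ => I), (fun _ _ => I); split=> //.
rewrite linear0 /= quot_mapE; apply/quot_pi_eq0; exists s => //.
apply: functional_extensionality_dep => -[w wW].
by rewrite /= (godement_unitE _ (set_mem wW)) -cs.
Qed.

(** Extension by zero, the reason why the Godement sheaf is flasque: every local cochain is the
    restriction of a global one. *)
Definition ext0 Z (U : opens X) (s : sec (godement Z) U) : dsec Z :=
  fun x => if pselect (oset U x) is left Ux then s (exist _ x (mem_set Ux))
           else 0.

Lemma ext0E Z (U : opens X) (s : sec (godement Z) U) (x : set_type U) :
  ext0 s (val x) = s x.
Proof.
rewrite /ext0; case: pselect => [Ux|]; last by case; exact: set_valP.
by case: x Ux => x /= xU Ux; rewrite (bool_irrelevance (mem_set Ux) xU).
Qed.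

Lemma delta_ext0 Z (U : opens X) (s : sec (godement Z) U) x (Ux : oset U x) :
  delta (ext0 s) x = @germ _ _ (godement_coker Z) x U Ux (quot_pi _ s).
Proof.
apply/germ_eqP; exists U, (fun _ _ => I), (fun=> id); split=> //.
rewrite res_id /= quot_mapE; congr quot_pi.
by apply: functional_extensionality_dep => w; exact: ext0E.
Qed.

(** A section of the unsheafified cokernel over [W] is the class of a cochain over [W], and that
    cochain extends by zero to the whole space. *)
Lemma reg_coker Z (c : dsec (godement_coker Z)) x :
  reg_at c x <-> exists e : dsec Z, \forall w \near x, c w = delta e w.
Proof.
split=> [[W [s [Wx]]]|[e /nbhs_opens[W Wx Wc]]].
  elim/quot_elim: s => s cs.
  exists (ext0 s); apply: filterS (opens_nbhs Wx) => w Ww.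
  by rewrite cs delta_ext0.
pose WX : W `<=` opens_full X := fun _ _ => I.
exists W, (@res _ _ (godement_coker Z) _ _ WX (quot_pi _ (full_sec e))).
by split=> // w Ww; rewrite Wc // (germ_res (I : oset (opens_full X) w)).
Qed.

Lemma reg_delta Z (c : dsec Z) x : reg_at (delta c) x.
Proof. by apply/reg_coker; exists c; exact: filterE. Qed.

(** Extension by zero again. Definitions and identities on the stalks of a syzygy can thus be
    reduced to germs of the form [delta c x]. *)
Lemma delta_surj Z x (u : stalk (godement_coker Z) x) :
  exists c : dsec Z, u = delta c x.
Proof.
elim/germ_elim: u => U Ux s; elim/quot_elim: s => s.
by exists (ext0 s); rewrite delta_ext0.
Qed.

(** [delta] is local: the difference vanishes near [x], so it is regular there and its differential
    has zero germ. *)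
Lemma delta_near Z (c c' : dsec Z) x :
  (\forall w \near x, c w = c' w) -> delta c x = delta c' x.
Proof.
move=> cc'; apply/subr0_eq; rewrite -[LHS]/((delta c - delta c') x).
rewrite -linearB; apply/delta_eq0/(reg_at_near_eq (@reg_at0 Z x)).
by apply: filterS cc' => w e; rewrite -[RHS]/(c w - c' w) e subrr.
Qed.

End DiscontinuousSections.

(** * Functoriality of the Godement resolution *)

(* A morphism over [phi] between the sheafifications of G and F, given by its
   action on stalks. *)
Record stalk_morphism (k : comNzRingType) (X Y : topologicalType) (phi : X -> Y)
    (G : presheaf k Y) (F : presheaf k X) := StalkMorphism {
  pull_at : forall x, {linear stalk G (phi x) -> stalk F x};
  pull_cont : continuous phi;
  pull_reg : forall (c : dsec G) x,
    reg_at c (phi x) -> reg_at ((fun y => pull_at y (c (phi y))) : dsec F) x }.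

Section Pull.
Variables (k : comNzRingType) (X Y : topologicalType) (phi : X -> Y).
Variables (G : presheaf k Y) (F : presheaf k X) (m : stalk_morphism phi G F).

Definition pull (c : dsec G) : dsec F := fun x => pull_at m x (c (phi x)).

Lemma pull_linear : linear pull.
Proof.
by move=> a c c'; apply: functional_extensionality_dep => x; exact: linearP.
Qed.
HB.instance Definition _ := GRing.isLinear.Build k _ _ *:%R pull pull_linear.

(** A chosen lift of the germ is pulled back. The choice does not matter, by [coker_pull_atE]: two
    lifts differ by a cochain regular at [phi x]. *)
Definition coker_pull_at x (u : stalk (godement_coker G) (phi x)) :
  stalk (godement_coker F) x := delta (pull (sval (cid (delta_surj u)))) x.

Lemma coker_pull_atE x (c : dsec G) :
  coker_pull_at (delta c (phi x)) = delta (pull c) x.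
Proof.
rewrite /coker_pull_at; case: cid => c' /= e; apply/subr0_eq.
rewrite -[LHS]/((delta (pull c') - delta (pull c)) x) -!linearB.
apply/delta_eq0/(@pull_reg _ _ _ _ _ _ m)/delta_eq0.
by rewrite linearB -[LHS]/(delta c' (phi x) - delta c (phi x)) -e subrr.
Qed.

Lemma coker_pull_at_linear x : linear (@coker_pull_at x).
Proof.
move=> a u v; have [c ->] := delta_surj u; have [c' ->] := delta_surj v.
rewrite -[X in coker_pull_at X]/((a *: delta c + delta c') (phi x)) -linearP.
by rewrite !coker_pull_atE !linearP.
Qed.
HB.instance Definition _ x :=
  GRing.isLinear.Build k _ _ *:%R (@coker_pull_at x) (@coker_pull_at_linear x).

Definition coker_stalk_morphism :
  stalk_morphism phi (godement_coker G) (godement_coker F).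
Proof.
refine (@StalkMorphism _ _ _ phi _ _ (fun x => @coker_pull_at x) (pull_cont m) _).
move=> c x /reg_coker[e ce]; apply/reg_coker; exists (pull e).
have ne : \forall w \near x, c (phi w) = delta e (phi w).
  exact: (pull_cont m ce).
by apply: filterS ne => w ->; exact: coker_pull_atE.
Defined.

End Pull.

Lemma pull_delta (k : comNzRingType) (X Y : topologicalType) (phi : X -> Y)
    (G : presheaf k Y) (F : presheaf k X) (m : stalk_morphism phi G F)
    (c : dsec G) :
  pull (coker_stalk_morphism m) (delta c) = delta (pull m c).
Proof. by apply: functional_extensionality_dep => x; exact: coker_pull_atE. Qed.

Lemma pull_coker_at (k : comNzRingType) (X Y : topologicalType) (phi : X -> Y)
    (G : presheaf k Y) (F : presheaf k X) (m : stalk_morphism phi G F)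
    (c : dsec (godement_coker G)) (e : dsec G) x :
  c (phi x) = delta e (phi x) ->
  pull (coker_stalk_morphism m) c x = delta (pull m e) x.
Proof. by rewrite -pull_delta /pull => ->. Qed.

Lemma pull_at_eq (k : comNzRingType) (X Y : topologicalType) (phi : X -> Y)
    (G : presheaf k Y) (F : presheaf k X) (m : stalk_morphism phi G F)
    (c c' : dsec G) x :
  c (phi x) = c' (phi x) -> pull m c x = pull m c' x.
Proof. by rewrite /pull => ->. Qed.

Section Syzygies.
Variables (k : comNzRingType) (X Y : topologicalType) (phi : X -> Y).
Variables (G : presheaf k Y) (F : presheaf k X) (m : stalk_morphism phi G F).

Fixpoint syz_morphism (n : nat) :
    stalk_morphism phi (godement_syz G n) (godement_syz F n) :=
  if n is n'.+1 then coker_stalk_morphism (syz_morphism n') else m.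

End Syzygies.

(** Induction on the degree: a germ in degree n + 1 is the differential of a cochain of degree n,
    and pull-backs commute with [delta]. *)
Lemma syz_morphismK (k : comNzRingType) (X Y : topologicalType)
    (phi : X -> Y) (psi : Y -> X) (G : presheaf k Y) (F : presheaf k X)
    (m : stalk_morphism phi G F) (m' : stalk_morphism psi F G) :
  cancel phi psi -> cancel (pull m') (pull m) ->
  forall n, cancel (pull (syz_morphism m' n)) (pull (syz_morphism m n)).
Proof.
move=> phiK mK; elim=> [//|n IHn] c; apply: functional_extensionality_dep => x.
have [e ce] := delta_surj (c x).
rewrite /= (@pull_coker_at _ _ _ _ _ _ _ _ (pull (syz_morphism m' n) e)).
  by rewrite IHn.
by rewrite -pull_delta; apply: pull_at_eq; rewrite phiK.
Qed.

(** Morphisms are never composed; two factorizations of one map are compared through their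
    pull-backs. It will serve for the homotopy at height 1 and the inclusion after the
    retraction. *)
Lemma syz_morphism_square (k : comNzRingType) (X Y Y' W : topologicalType)
    (f : X -> Y) (g : Y -> W) (f' : X -> Y') (g' : Y' -> W)
    (F : presheaf k X) (G : presheaf k Y) (G' : presheaf k Y')
    (H : presheaf k W)
    (mf : stalk_morphism f G F) (mg : stalk_morphism g H G)
    (mf' : stalk_morphism f' G' F) (mg' : stalk_morphism g' H G') :
  g \o f =1 g' \o f' ->
  (forall c, pull mf (pull mg c) = pull mf' (pull mg' c)) ->
  forall n c, pull (syz_morphism mf n) (pull (syz_morphism mg n) c) =
    pull (syz_morphism mf' n) (pull (syz_morphism mg' n) c).
Proof.
move=> e0 em; elim=> [//|n IHn] c; apply: functional_extensionality_dep => x.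
have [e ce] := delta_surj (c (g (f x))).
rewrite /= (@pull_coker_at _ _ _ _ _ _ _ _ (pull (syz_morphism mg n) e)).
  rewrite (@pull_coker_at _ _ _ _ _ _ _ _ (pull (syz_morphism mg' n) e)).
    by rewrite IHn.
  by rewrite -pull_delta; apply: pull_at_eq; move: (e0 x) => /= <-.
by rewrite -pull_delta; exact: pull_at_eq.
Qed.

(** * Cohomology classes represented by regular cochains, and their pull-back *)

Section Cohomology.
Variables (k : comNzRingType) (X : topologicalType) (F : presheaf k X).

Definition unfull Z (s : sec (@godement k X Z) (opens_full X)) : dsec Z :=
  fun x => s (exist (fun y => y \in oset (opens_full X)) x (mem_set I)).

Lemma unfull_linear Z : linear (@unfull Z).
Proof. by []. Qed.
HB.instance Definition _ Z :=
  GRing.isLinear.Build k _ _ *:%R (@unfull Z) (@unfull_linear Z).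

Lemma full_sec_linear Z : linear (@full_sec k X Z).
Proof. by []. Qed.
HB.instance Definition _ Z :=
  GRing.isLinear.Build k _ _ *:%R (@full_sec k X Z) (@full_sec_linear Z).

Lemma full_secK Z : cancel (@full_sec k X Z) (@unfull Z).
Proof. by []. Qed.

Lemma unfullK Z : cancel (@unfull Z) (@full_sec k X Z).
Proof.
move=> s; apply: functional_extensionality_dep => -[x xX].
by rewrite /unfull /full_sec /= (bool_irrelevance (mem_set _) xX).
Qed.

Lemma godement_diffE n (c : dsec (godement_syz F n)) :
  godement_diff F n (full_sec c) = full_sec (delta c).
Proof.
apply: functional_extensionality_dep => -[x xX].
by rewrite /= (godement_unitE _ (I : oset (opens_full X) x)).
Qed.

Lemma ker_full n (c : dsec (godement_syz F n)) :
  sm_set (ker_submod (godement_diff F n)) (full_sec c) <->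
  forall x, reg_at c x.
Proof.
rewrite -[sm_set _ _]/(godement_diff F n (full_sec c) = 0) godement_diffE.
split=> [e x|rc].
  by apply/delta_eq0; rewrite -[delta c]full_secK e.
rewrite (_ : delta c = 0); first exact: linear0.
by apply: functional_extensionality_dep => x; apply/delta_eq0.
Qed.

Definition coboundary n : dsec (godement_syz F n) -> Prop :=
  match n with
  | 0 => fun c => c = 0
  | n'.+1 => fun c => exists e, c = delta e
  end.

Lemma cobound_full n (c : dsec (godement_syz F n)) :
  sm_set (godement_cobound F n) (full_sec c) <-> coboundary c.
Proof.
case: n c => [|n] c /=.
  split=> [e|->]; last exact: linear0.
  by rewrite -[c]full_secK e linear0.
split=> [[s _ e]|[e ->]]; last by exists (full_sec e) => //; exact: godement_diffE.
exists (unfull s); apply: (can_inj (@full_secK _)).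
by rewrite -godement_diffE unfullK.
Qed.

Definition cocycle n (c : dsec (godement_syz F n)) (rc : forall x, reg_at c x) :
    submod_type (ker_submod (godement_diff F n)) :=
  exist (fun s => s \in sm_set (ker_submod (godement_diff F n))) _
    (mem_set (proj2 (ker_full c) rc)).

Definition cohomology_class n (c : dsec (godement_syz F n))
    (rc : forall x, reg_at c x) : sheaf_cohomology F n :=
  quot_pi _ (cocycle rc).

Lemma cohomology_class_eq n (c c' : dsec (godement_syz F n)) rc rc' :
  coboundary (c - c') ->
  @cohomology_class n c rc = @cohomology_class n c' rc'.
Proof.
by move=> /cobound_full cc'; apply/Defs.quotP; rewrite /= -linearB.
Qed.

Lemma cohomology_elim n (u : sheaf_cohomology F n) :
  exists c rc, u = @cohomology_class n c rc.
Proof.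
elim/quot_elim: u => -[s sZ].
have rc x : reg_at (unfull s) x.
  by move: x; apply/ker_full; rewrite unfullK; exact: set_mem.
exists (unfull s), rc; congr quot_pi.
by apply: val_inj; rewrite /= unfullK.
Qed.

End Cohomology.

Section CohomologyPull.
Variables (k : comNzRingType) (X Y : topologicalType) (phi : X -> Y).
Variables (G : presheaf k Y) (F : presheaf k X) (m : stalk_morphism phi G F).
Variable n : nat.

Definition cochain_pull :
    {linear godement_cochain G n -> godement_cochain F n} :=
  (@full_sec _ _ _ \o pull (syz_morphism m n) \o @unfull _ _ _)%FUN.

Lemma cochain_pull_ker s : sm_set (ker_submod (godement_diff G n)) s ->
  sm_set (ker_submod (godement_diff F n)) (cochain_pull s).
Proof.
rewrite -{1}(unfullK s) => /ker_full rs; apply/ker_full => x.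
exact: pull_reg (rs _).
Qed.

Lemma pull_coboundary (c : dsec (godement_syz G n)) :
  coboundary c -> coboundary (pull (syz_morphism m n) c).
Proof.
case: n c => [|n'] c /= => [->|[e ->]]; first exact: linear0.
by exists (pull (syz_morphism m n') e); rewrite pull_delta.
Qed.

Lemma cochain_pull_cobound (s : submod_type (ker_submod (godement_diff G n))) :
  sm_set (preim_submod (val : {linear submod_type _ -> _})
    (godement_cobound G n)) s ->
  sm_set (preim_submod (val : {linear submod_type _ -> _})
    (godement_cobound F n)) (Defs.sub_map cochain_pull_ker s).
Proof.
rewrite /= -{1}(unfullK (val s)) => /cobound_full/pull_coboundary.
by move/cobound_full.
Qed.

Definition cohomology_pull :
    {linear sheaf_cohomology G n -> sheaf_cohomology F n} :=
  quot_map (f := Defs.sub_map cochain_pull_ker) cochain_pull_cobound.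

Lemma cohomology_pullE c rc :
  cohomology_pull (@cohomology_class _ _ G n c rc) =
  cohomology_class (fun x => pull_reg (syz_morphism m n) (rc (phi x))).
Proof.
have e : Defs.sub_map cochain_pull_ker (cocycle rc) =
    cocycle (fun x => pull_reg (syz_morphism m n) (rc (phi x))).
  exact: val_inj.
rewrite /cohomology_class -e; exact: quot_mapE.
Qed.

End CohomologyPull.

(** * Homotopy invariance *)

Section UnitInterval.
Variable R : realType.

Definition unit_itv : topologicalType := set_type (`[0, 1]%classic : set R).

Fact unit_itv_subproof (r : R) : 0 <= r <= 1 -> r \in (`[0, 1]%classic : set R).
Proof. by rewrite inE /= in_itv. Qed.

Definition in_unit_itv (r : R) (r01 : 0 <= r <= 1) : unit_itv :=
  exist (fun z => z \in (`[0, 1]%classic : set R)) r (unit_itv_subproof r01).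

Definition itv_val (t : unit_itv) : R := set_val t.

Lemma itv_val_inj : injective itv_val.
Proof. exact: val_inj. Qed.

Lemma itv_val_continuous : continuous itv_val.
Proof. exact: initial_continuous. Qed.

Lemma unit_itvP (t : unit_itv) : 0 <= itv_val t <= 1.
Proof. by have := set_valP t; rewrite /= in_itv. Qed.

Definition itv0 : unit_itv := @in_unit_itv 0 ltac:(by rewrite lexx ler01).
Definition itv1 : unit_itv := @in_unit_itv 1 ltac:(by rewrite lexx ler01).

Fact clamp_subproof (r : R) : 0 <= Num.max 0 (Num.min r 1) <= 1.
Proof. by rewrite le_max lexx /= ge_max ler01 ge_min lexx orbT. Qed.

(** A retraction of the line onto the interval, through which compactness and connectedness reach
    the subtype. *)
Definition clamp (r : R) : unit_itv := in_unit_itv (clamp_subproof r).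

Lemma clampK (t : unit_itv) : clamp (itv_val t) = t.
Proof.
apply: itv_val_inj; have /andP[t0 t1] := unit_itvP t.
rewrite -[LHS]/(Num.max 0 (Num.min (itv_val t) 1)).
by rewrite (min_idPl t1) (max_idPr t0).
Qed.

Lemma clamp_continuous : continuous clamp.
Proof.
apply: continuous_comp_initial => r /=.
apply: (@continuous_max R R (cst 0) (fun r => Num.min r 1)).
  exact: cst_continuous.
apply: (@continuous_min R R id (cst 1)) => //.
exact: cst_continuous.
Qed.

Lemma image_clamp : clamp @` setT = setT.
Proof. by apply/seteqP; split=> // t _; exists (itv_val t) => //; exact: clampK. Qed.

Lemma unit_itv_compact : compact [set: unit_itv].
Proof.
rewrite (_ : setT = clamp @` `[0, 1]).
  apply: continuous_compact; last exact: segment_compact.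
  exact/continuous_subspaceT/clamp_continuous.
apply/seteqP; split=> // t _; exists (itv_val t); last exact: clampK.
by rewrite /= in_itv /= unit_itvP.
Qed.

Lemma unit_itv_connected : connected [set: unit_itv].
Proof.
rewrite -image_clamp; apply: connected_continuous_connected.
  exact/connected_intervalP.
exact/continuous_subspaceT/clamp_continuous.
Qed.

(** Connectedness: [Q] and its complement are both open. *)
Lemma unit_itv_locally_constant (Q : unit_itv -> Prop) :
  (forall t, \forall t' \near t, Q t <-> Q t') -> Q itv0 -> forall t, Q t.
Proof.
move=> Qloc Q0 t.
have oQ : open Q.
  rewrite openE => s Qs; have := Qloc s; rewrite /interior; apply: filterS => s'.
  by case=> + _; apply.
have oQ' : open (~` Q).
  rewrite openE => s Qs; have := Qloc s; rewrite /interior; apply: filterS => s'.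
  by case=> _ Qs's /Qs's.
suff -> : Q = setT by [].
apply: unit_itv_connected; first by exists itv0.
- by exists Q; rewrite ?setTI.
- by exists Q; rewrite ?setTI // -openC.
Qed.

Lemma unit_itv_nbhsP (t : unit_itv) (A : set unit_itv) : nbhs t A ->
  exists2 e : R, 0 < e & forall s : unit_itv, `|itv_val t - itv_val s| < e -> A s.
Proof.
move=> [_ [[B oB <-] Bt] BA].
have /nbhs_ballP[e e0 eB] : nbhs (itv_val t) B by apply: open_nbhs_nbhs; split.
by exists e => // s ts; apply: BA; exact: eB.
Qed.

End UnitInterval.

(** * Cocycles on an abstract cylinder with projection [p], sections [i t] and height [tau] *)

Section Homotopy.
Variables (k : comNzRingType) (R : realType) (X Xt : topologicalType).
Variables (F : presheaf k X) (Ft : presheaf k Xt).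
Variables (i : unit_itv R -> X -> Xt) (p : Xt -> X) (tau : Xt -> unit_itv R).
Hypothesis itauK : forall z, i (tau z) (p z) = z.
Hypothesis iK : forall t, cancel (i t) p.
Hypothesis tauK : forall t x, tau (i t x) = t.
Hypothesis i_cont : continuous (fun q : X * unit_itv R => i q.2 q.1).
Hypothesis tau_cont : continuous tau.
Variables (P : stalk_morphism p F Ft).
Variables (J : forall t, stalk_morphism (i t) Ft F).
Hypothesis PK : forall t, cancel (pull P) (pull (J t)).
Hypothesis JK : forall (c : dsec Ft) t x, pull P (pull (J t) c) (i t x) = c (i t x).

Let i0 := i (itv0 R).
Let Pn n := syz_morphism P n.
Let J0n n := syz_morphism (J (itv0 R)) n.
Let tube (U : set X) : set Xt := p @^-1` U.

Lemma near_fiber x t (Q : Xt -> Prop) : (\forall z \near i t x, Q z) ->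
  \forall x' \near x & s \near t, Q (i s x').
Proof. by move=> Qi; exact: (@i_cont (x, t) _ Qi). Qed.

Lemma near_fiber_itv x t (Q : Xt -> Prop) : (\forall z \near i t x, Q z) ->
  \forall s \near t, Q (i s x).
Proof.
move=> /near_fiber[[A B] /= [Ax Bt] AB].
by apply: filterS Bt => s Bs; apply: (AB (x, s)); split=> //; exact: nbhs_singleton.
Qed.

(** The tube lemma, from compactness of the interval and joint continuity of [i]. *)
Lemma near_tube x (Q : Xt -> Prop) : (forall t, \forall z \near i t x, Q z) ->
  exists2 V : opens X, oset V x & forall z, tube V z -> Q z.
Proof.
move=> Qx; have /compact_near_coveringP cI := @unit_itv_compact R.
have [|V Vx VQ] := @nbhs_opens _ x (fun x' => [set: unit_itv R] `<=` (fun t => Q (i t x'))).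
  apply: cI => t _; have [[A B] /= [Ax Bt] AB] := near_fiber (Qx t).
  by exists (B, A) => //= -[s x'] [/= Bs Ax']; exact: (AB (x', s)).
by exists V => // z Vz; rewrite -(itauK z); exact: VQ.
Qed.

Lemma reg_pullP n (b : dsec (godement_syz F n)) z :
  reg_at b (p z) -> reg_at (pull (Pn n) b) z.
Proof. exact: pull_reg. Qed.

(** In degree 0 the restriction to height [t] is pulled back along [p]. In positive degree the germ
    is that of the differential of a global cochain, which is regular everywhere. *)
Lemma extend_fiber n (e : dsec (godement_syz Ft n)) t x : reg_at e (i t x) ->
  exists2 f : dsec (godement_syz Ft n),
    f (i t x) = e (i t x) & forall s, reg_at f (i s x).
Proof.
case: n e => [|n] e re.
  exists (pull P (pull (J t) e)); first exact: JK.
  by move=> s; apply: pull_reg; rewrite iK; exact: pull_reg.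
have [c ec] := delta_surj (e (i t x)).
by exists (delta c) => // s; exact: reg_delta.
Qed.

(** The difference of the two primitives is regular at height [t]; its germ extends to a cochain [f]
    regular along the fibre, and adding [f] to [e2] changes no differential there. *)
Lemma glue_fiber n (c : dsec (godement_syz Ft n.+1)) (e1 e2 : dsec (godement_syz Ft n)) x t :
  delta e1 (i t x) = c (i t x) -> delta e2 (i t x) = c (i t x) ->
  exists e, (forall s, itv_val s <= itv_val t -> delta e1 (i s x) = c (i s x) ->
                delta e (i s x) = c (i s x)) /\
            (forall s, itv_val t < itv_val s -> delta e2 (i s x) = c (i s x) ->
                delta e (i s x) = c (i s x)).
Proof.
move=> h1 h2.
have re : reg_at (e1 - e2) (i t x).
  apply/delta_eq0; rewrite linearB -[LHS]/(delta e1 (i t x) - delta e2 (i t x)).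
  by rewrite h1 h2 subrr.
have [f fe rf] := extend_fiber re.
have fnear := reg_at_agree (rf t) re fe.
(* Near [i t x] the second branch also equals [e1], by [fnear], so the change of formula at height
   [t] is invisible. *)
pose e : dsec (godement_syz Ft n) :=
  fun z => if itv_val (tau z) <= itv_val t then e1 z else (e2 + f) z.
have vtau : continuous (fun z => itv_val (tau z) : R).
  move=> z; apply: continuous_comp; first exact: tau_cont.
  exact: itv_val_continuous.
exists e; split=> s st.
  move=> <-; apply: delta_near.
  move: st; rewrite le_eqVlt => /orP[/eqP/itv_val_inj ->|st].
    apply: filterS fnear => z; rewrite /e; case: ifP => // _ fz.
    by rewrite -[LHS]/(e2 z + f z) fz -[e1 in RHS](subrK e2) addrC.
  have : \forall z \near i s x, itv_val (tau z) < itv_val t.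
    have := vtau (i s x); rewrite /continuous_at tauK => /(_ [set r | r < itv_val t]).
    by apply; exact: lt_nbhsl.
  by apply: filterS => z zt; rewrite /e ltW.
move=> <-; transitivity (delta (e2 + f) (i s x)).
  apply: delta_near.
  have : \forall z \near i s x, itv_val t < itv_val (tau z).
    have := vtau (i s x); rewrite /continuous_at tauK => /(_ [set r | itv_val t < r]).
    by apply; exact: lt_nbhsr.
  by apply: filterS => z zt; rewrite /e leNgt zt.
rewrite linearD -[LHS]/(delta e2 (i s x) + delta f (i s x)).
by rewrite (proj2 (delta_eq0 _ _) (rf s)) addr0.
Qed.

(** Having a primitive up to height [t] is a locally constant condition on [t] that holds at 0. *)
Lemma lift_fiber n (c : dsec (godement_syz Ft n.+1)) x :
  (forall t, reg_at c (i t x)) ->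
  exists e : dsec (godement_syz Ft n), forall t, delta e (i t x) = c (i t x).
Proof.
move=> rc; pose Q (t : unit_itv R) := exists e : dsec (godement_syz Ft n),
  forall s, itv_val s <= itv_val t -> delta e (i s x) = c (i s x).
have local t : exists2 d : R, 0 < d & exists e : dsec (godement_syz Ft n),
    forall s, `|itv_val t - itv_val s| < d -> delta e (i s x) = c (i s x).
  have /reg_coker[e /near_fiber_itv/unit_itv_nbhsP[d d0 de]] := rc t.
  by exists d => //; exists e => s /de.
suff Qall t : Q t.
  have [e ce] := Qall (itv1 R).
  by exists e => t; apply: ce; have /andP[] := unit_itvP t.
apply: unit_itv_locally_constant => {t} [t|].
  have [d d0 [e' ce']] := local t.
  have step a b : `|itv_val t - itv_val a| < d -> `|itv_val t - itv_val b| < d -> Q a -> Q b.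
    move=> ta tb [e ce]; have [ba|ab] := leP (itv_val b) (itv_val a).
      by exists e => s sb; apply: ce; exact: le_trans ba.
    (* The primitive up to [a] is continued by the local one [e'], the two being glued at height
       [a]. *)
    have [f [f1 f2]] := glue_fiber (ce a (lexx _)) (ce' a ta).
    exists f => s sb; have [sa|sa] := leP (itv_val s) (itv_val a).
      by apply: f1 => //; exact: ce.
    apply: f2 => //; apply: ce'; move: ta tb sa sb ab.
    rewrite !ltr_distlC => /andP[a1 a2] /andP[b1 b2] sa sb ab.
    by rewrite (lt_trans a1 sa) (le_lt_trans sb b2).
  have : nbhs t [set s : unit_itv R | `|itv_val t - itv_val s| < d].
    have := @itv_val_continuous R t; move=> ct.
    by apply: (ct [set r | `|itv_val t - r| < d]); exact: nbhsx_ballx.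
  apply: filterS => s ts; have tt : `|itv_val t - itv_val t| < d by rewrite subrr normr0.
  by split; apply: step.
have [d d0 [e ce]] := local (itv0 R); exists e => s s0; apply: ce.
have -> : itv_val s = itv_val (itv0 R).
  by apply/le_anti; rewrite s0; have /andP[] := unit_itvP s.
by rewrite subrr normr0.
Qed.

Let normalized n (c : dsec (godement_syz Ft n)) := pull (J0n n) c = 0.

Lemma pullK0 n : cancel (pull (Pn n)) (pull (J0n n)).
Proof. exact: syz_morphismK. Qed.

(** A primitive along the fibre is one over a tube, as regular cochains that agree at a point agree
    nearby. Subtracting the pull-back of its restriction to height 0 normalizes it. *)
Lemma lift_tube n (c : dsec (godement_syz Ft n.+1)) x :
  (forall t, reg_at c (i t x)) -> (\forall y \near x, pull (J0n n.+1) c y = 0) ->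
  exists (V : opens X) (e : dsec (godement_syz Ft n)),
    [/\ oset V x, normalized e & forall z, tube V z -> delta e z = c z].
Proof.
move=> rc /nbhs_opens[W Wx Wc]; have [e0 ce0] := lift_fiber rc.
have [V Vx Vc] : exists2 V : opens X, oset V x &
    forall z, tube V z -> delta e0 z = c z.
  apply: near_tube => t.
  exact: reg_at_agree (reg_delta _ _) (rc t) (ce0 t).
pose b := pull (J0n n) e0.
(* The differential of [b] is the restriction of [c] to height 0, which vanishes here; so
   subtracting the pull-back of [b] preserves the differential. *)
have rb y : oset (opens_meet V W) y -> reg_at b y.
  move=> [Vy Wy]; apply/delta_eq0; rewrite -(@pull_delta _ _ _ _ _ _ (J0n n)).
  rewrite -[RHS](Wc y Wy); apply: (@pull_at_eq _ _ _ _ _ _ (J0n n.+1)).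
  by apply: Vc; rewrite /tube /= iK.
exists (opens_meet V W), (e0 - pull (Pn n) b); split; first by split.
  by rewrite /normalized linearB /= pullK0 subrr.
move=> z [Vz Wz]; rewrite linearB -[LHS]/(delta e0 z - delta (pull (Pn n) b) z).
rewrite Vc // (proj2 (delta_eq0 (pull (Pn n) b) z)) ?subr0 //.
by apply: reg_pullP; apply: rb.
Qed.

(** Near each height [c] is pulled back from the base, so its vanishing is a locally constant
    condition along the fibre, true at height 0. *)
Lemma vanish_tube (c : dsec Ft) (U : set X) :
  (forall z, tube U z -> reg_at c z) ->
  (forall x, U x -> pull (J (itv0 R)) c x = 0) ->
  forall z, tube U z -> c z = 0.
Proof.
move=> rc c0 z Uz; rewrite -(itauK z); have Ux : U (p z) := Uz.
move: (p z) (tau z) Ux => x t Ux {z Uz}.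
have tubeU s : tube U (i s x) by rewrite /tube /= iK.
have near_pull s : \forall s' \near s,
    c (i s' x) = pull P (pull (J s) c) (i s' x).
  apply: (@near_fiber_itv x s (fun z => c z = pull P (pull (J s) c) z)).
  apply: reg_at_agree; first exact/rc/tubeU.
    by apply: pull_reg; rewrite iK; apply/pull_reg/rc/tubeU.
  by rewrite JK.
(* If the germ at height [s'] is the pull-back of the restriction to height [s], then [PK] recovers
   that restriction from it, so both vanish together. *)
have zero_iff s s' : c (i s' x) = pull P (pull (J s) c) (i s' x) ->
    (c (i s' x) = 0 <-> pull (J s) c x = 0).
  move=> e; split=> [cs'|b0].
    rewrite -[pull (J s) c](PK s') -[RHS](linear0 (pull_at (J s') x)).
    by rewrite {1}/pull -e cs'.
  rewrite e -[RHS](linear0 (pull_at P (i s' x))) {1}/pull.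
  by congr (pull_at P _ _); rewrite iK.
apply: (@unit_itv_locally_constant R (fun s => c (i s x) = 0)) => [s|].
  apply: filterS (near_pull s) => s' e.
  apply: iff_trans (iff_sym (zero_iff s s' e)).
  by apply: zero_iff; rewrite JK.
have [_] := zero_iff (itv0 R) (itv0 R) (esym (JK _ _ _)).
by apply; exact: c0.
Qed.

Lemma tube_nbhs (U : opens X) z : tube U z -> \forall w \near z, tube U w.
Proof. by move=> Uz; exact: (pull_cont P (opens_nbhs Uz)). Qed.

(** Flasqueness of the sheaf on X whose sections over [U] are the cocycles on the tube over [U] that
    vanish at height 0. *)
Definition flasque_kernel n := forall (U : opens X) (d : dsec (godement_syz Ft n)),
  (forall z, tube U z -> reg_at d z) ->
  (forall x, oset U x -> pull (J0n n) d x = 0) ->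
  exists d' : dsec (godement_syz Ft n),
    [/\ forall z, tube U z -> d' z = d z, forall z, reg_at d' z & normalized d'].

Definition primitive n (c : dsec (godement_syz Ft n.+1)) (U : opens X)
    (e : dsec (godement_syz Ft n)) : Prop :=
  normalized e /\ forall z, tube U z -> delta e z = c z.

(** Over the intersection [e - e'] is a cocycle vanishing at height 0; its global extension [d]
    corrects [e'] so that it agrees with [e] there. *)
Lemma primitive_union n (c : dsec (godement_syz Ft n.+1)) (V W : opens X) e e' :
  flasque_kernel n -> primitive c V e -> primitive c W e' ->
  exists (VW : opens X) e'', [/\ oset VW = oset V `|` oset W, primitive c VW e'' &
    forall z, tube V z -> e'' z = e z].
Proof.
move=> ext [ne ce] [ne' ce'].
have [z Vz|x Vx|d [de rd nd]] := ext (opens_meet V W) (e - e').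
- apply/delta_eq0; rewrite linearB -[LHS]/(delta e z - delta e' z).
  by have [zV zW] := Vz; rewrite ce // ce' // subrr.
- rewrite linearB -[LHS]/(pull (J0n n) e x - pull (J0n n) e' x).
  by rewrite ne ne' subrr.
pose f : dsec (godement_syz Ft n) :=
  fun z => if pselect (tube V z) then e z else (e' + d) z.
have fV z : tube V z -> f z = e z by rewrite /f; case: pselect.
have fW z : tube W z -> f z = (e' + d) z.
  move=> Wz; rewrite /f; case: pselect => // Vz.
  by rewrite -[RHS]/(e' z + d z) de // -[(e - e') z]/(e z - e' z) addrC subrK.
exists (Opens (openU (osetP V) (osetP W))), f; split=> //; split.
  apply: functional_extensionality_dep => x.
  have [Vx|Vx] := pselect (tube V (i0 x)).
    by rewrite (@pull_at_eq _ _ _ _ _ _ (J0n n) f e) ?ne //; exact: fV.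
  rewrite (@pull_at_eq _ _ _ _ _ _ (J0n n) f (e' + d)).
    rewrite linearD -[LHS]/(pull (J0n n) e' x + pull (J0n n) d x).
    by rewrite ne' nd addr0.
  by rewrite /f; case: pselect.
move=> z [Vz|Wz].
  by rewrite -ce //; apply: delta_near; apply: filterS (tube_nbhs Vz) => w /fV.
transitivity (delta (e' + d) z).
  by apply: delta_near; apply: filterS (tube_nbhs Wz) => w /fW.
rewrite linearD -[LHS]/(delta e' z + delta d z) ce' //.
by rewrite (proj2 (delta_eq0 _ _) (rd z)) addr0.
Qed.

(** Zorn's lemma for primitives over tubes, ordered by extension: [lift_tube] and [primitive_union]
    enlarge a primitive around any point of [U], so a maximal one covers [U]. *)
Lemma exact_tube n (c : dsec (godement_syz Ft n.+1)) (U : opens X) :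
  flasque_kernel n -> (forall z, tube U z -> reg_at c z) ->
  (forall x, oset U x -> pull (J0n n.+1) c x = 0) ->
  exists e, primitive c U e.
Proof.
move=> ext rc c0.
pose T := {q : opens X * dsec (godement_syz Ft n) | primitive c q.1 q.2}.
pose le (a b : T) := `[< oset (sval a).1 `<=` oset (sval b).1 /\
  forall z, tube (sval a).1 z -> (sval b).2 z = (sval a).2 z >].
have prim0 : primitive c (Opens (@open0 X)) 0 by split=> //; exact: linear0.
have [|||[[V e] /= prim] max] := @ZL_preorder T (exist _ (_, _) prim0) le.
- by move=> a; apply/asboolP; split.
- move=> b a d /asboolP[ab eab] /asboolP[bd ebd]; apply/asboolP; split=> [x /ab/bd//|z az].
  by rewrite ebd ?eab //; exact: ab.
- move=> A Atot.
  pose V := \bigcup_(a in A) oset (sval a).1.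
  have oV : open V by apply: bigcup_open => a _; exact: osetP.
  (* Any member of the chain defined at the point may give the value, since they agree; zero
     elsewhere keeps [e] normalized. *)
  pose e : dsec (godement_syz Ft n) := fun z =>
    if pselect (exists2 a, A a & tube (sval a).1 z) is left h
    then (sval (sval (cid2 h))).2 z else 0.
  have eA a z : A a -> tube (sval a).1 z -> e z = (sval a).2 z.
    move=> Aa az; rewrite /e; case: pselect => [h|[]]; last by exists a.
    case: cid2 => b Ab bz /=.
    by have [/asboolP[_ ->]|/asboolP[_ ->]] := Atot _ _ Aa Ab.
  have prim : primitive c (Opens oV) e.
    split=> [|z [a Aa az]].
      apply: functional_extensionality_dep => x.
      have [[a Aa ax]|none] := pselect (exists2 a, A a & tube (sval a).1 (i0 x)).
        rewrite (@pull_at_eq _ _ _ _ _ _ (J0n n) e (sval a).2); last exact: eA.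
        by rewrite (proj1 (proj2_sig a)).
      rewrite (@pull_at_eq _ _ _ _ _ _ (J0n n) e 0) ?linear0 //.
      by rewrite /e; case: pselect.
    rewrite -(proj2 (proj2_sig a)) //; apply: delta_near.
    by apply: filterS (tube_nbhs az) => w; exact: eA.
  exists (exist _ (Opens oV, e) prim) => a Aa; apply/asboolP; split=> /= [x ax|z az].
    by exists a.
  exact: eA.
exists e; split=> [|z Uz]; first exact: prim.1.
have [t|/=|W [e' [Wx ne' ce']]] := @lift_tube n c (p z).
- by apply: rc; rewrite /tube /= iK.
- by apply: filterS (opens_nbhs Uz) => y; exact: c0.
have [VW [f [eVW primf fV]]] := primitive_union ext prim (conj ne' ce').
have /asboolP[/= VWV _] : le (exist _ (VW, f) primf) (exist _ (V, e) prim).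
  by apply: max; apply/asboolP; split=> //= x Vx; rewrite eVW; left.
by apply: prim.2; apply: VWV; rewrite eVW; right.
Qed.

(** In degree 0 such a cocycle is zero on the tube, hence extended by 0. In degree n + 1 it has a
    primitive over the tube, whose differential on the whole cylinder is the extension. *)
Lemma flasque_kernels n : flasque_kernel n.
Proof.
elim: n => [|n IHn] U d rd d0.
  exists 0; split=> [z Uz|z|]; last exact: linear0.
    by rewrite (vanish_tube rd d0).
  exact: reg_at0.
have [e [ne de]] := exact_tube IHn rd d0.
exists (delta e); split=> // [z|]; first exact: reg_delta.
by rewrite /normalized pull_delta ne linear0.
Qed.

Lemma fiber_coboundary n (c : dsec (godement_syz Ft n)) :
  (forall z, reg_at c z) -> coboundary (c - pull (Pn n) (pull (J0n n) c)).
Proof.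
move=> rc; set d := c - _.
have rd z : reg_at d z by apply: reg_atB => //; do 2 apply: pull_reg.
have d0 x : pull (J0n n) d x = 0 by rewrite linearB /= pullK0 subrr.
case: n c rc @d rd d0 => [|n] c rc d rd d0 /=.
  apply: functional_extensionality_dep => z.
  by apply: (@vanish_tube d setT).
have [e [_ de]] := @exact_tube n d (opens_full X) (@flasque_kernels n) (fun z _ => rd z)
  (fun x _ => d0 x).
by exists e; apply: functional_extensionality_dep => z; rewrite de.
Qed.

(** The coboundary of [fiber_coboundary] is pulled back to height [t], where pulling back along [p]
    is undone. *)
Lemma homotopy_coboundary n t (c : dsec (godement_syz Ft n)) :
  (forall z, reg_at c z) ->
  coboundary (pull (syz_morphism (J t) n) c - pull (J0n n) c).
Proof.
move=> /fiber_coboundary/(pull_coboundary (J t)).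
rewrite linearB /= [pull _ (pull (Pn n) _)]syz_morphismK //; exact: PK.
Qed.

End Homotopy.

(** * Stalks of the equivariant sheaf *)

Section EquivariantStalks.
Variables (k : comNzRingType) (G : groupType) (Y : topologicalType).
Variables (a : action G Y) (E : lmodType k) (rho : representation G E).

Local Notation O := (orbit_space a).
Local Notation S := (equivariant_sheaf a rho).

Definition orbit_pi (y : Y) : O := \pi_O y.

Lemma orbit_piP y y' : orbit_pi y = orbit_pi y' <-> exists g, y' = a g y.
Proof.
rewrite /orbit_pi; split=> [/eqmodP/asboolP//|e]; exact/eqmodP/asboolP.
Qed.

Lemma orbit_pi_act g y : orbit_pi (a g y) = orbit_pi y.
Proof. by apply/esym/orbit_piP; exists g. Qed.

Lemma orbit_pi_continuous : continuous orbit_pi.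
Proof. exact: pi_continuous. Qed.

Lemma orbit_pi_surj x : exists y, orbit_pi y = x.
Proof. by exists (repr x); rewrite /orbit_pi reprK. Qed.

(** Sections over [U] are represented by functions on all of Y constrained only over [U], so that
    restriction leaves the function unchanged. *)
Definition equivariant_on (U : opens O) (f : Y -> E) : Prop :=
  (forall y, oset U (orbit_pi y) -> \forall y' \near y, f y' = f y) /\
  (forall g y, oset U (orbit_pi y) -> f (a g y) = rho g (f y)).

Lemma equivariant_onS (U V : opens O) f :
  oset V `<=` oset U -> equivariant_on U f -> equivariant_on V f.
Proof. by move=> VU [lf ef]; split=> [y /VU|g y /VU]; [exact: lf|exact: ef]. Qed.

Lemma equivariant_onP (U : opens O) (b : k) f f' :
  equivariant_on U f -> equivariant_on U f' ->
  equivariant_on U (fun y => b *: f y + f' y).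
Proof.
move=> [lf ef] [lf' ef']; split=> [y Uy|g y Uy]; last by rewrite ef // ef' // linearP.
by apply: filterS2 (lf y Uy) (lf' y Uy) => y' -> ->.
Qed.

Fact section_of_subproof (U : opens O) f (h : equivariant_on U f) :
  (fun y : set_type (orbit_preim U) => f (val y)) \in
    sm_set (equivariant_sec rho U).
Proof.
rewrite inE; case: h => lf ef; split=> [y|g y y' -> ]; last first.
  by apply: ef; exact: (set_valP y).
have vc : continuous (set_val : set_type (orbit_preim U) -> Y).
  exact: initial_continuous.
exact: (vc y _ (lf (set_val y) (set_valP y))).
Qed.

Definition section_of (U : opens O) f (h : equivariant_on U f) :
    sec (equivariant_presheaf a rho) U :=
  exist (fun s => s \in sm_set (equivariant_sec rho U)) _ (section_of_subproof h).

Lemma section_of_res (U V : opens O) (VU : oset V `<=` oset U) f h h' :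
  res VU (@section_of U f h) = @section_of V f h'.
Proof. exact: val_inj. Qed.

(** The section is extended by zero; local constancy carries over to Y because the preimage of [U]
    is open. *)
Lemma sectionP (U : opens O) (t : sec (equivariant_presheaf a rho) U) :
  exists f h, t = @section_of U f h.
Proof.
case: t => t tP; have [lt et] := set_mem tP.
pose f y := if pselect (orbit_preim U y) is left Uy then t (exist _ y (mem_set Uy)) else 0.
have fE (y : set_type (orbit_preim U)) : f (val y) = t y.
  rewrite /f; case: pselect => [Uy|[]]; last exact: (set_valP y).
  by congr t; apply: val_inj.
have h : equivariant_on U f.
  split=> [y Uy|g y Uy].
    have [_ [[B oB <-] By] BA] := lt (exist _ y (mem_set Uy)).
    have oU : open (orbit_preim U : set Y).
      by apply: open_comp => [x _|]; [exact: pi_continuous|exact: osetP].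
    have : nbhs y (B `&` orbit_preim U).
      by apply: open_nbhs_nbhs; split; [exact: openI|split].
    apply: filterS => y' [By' Uy'].
    rewrite -[y']/(val (exist (fun z => z \in orbit_preim U) y' (mem_set Uy'))).
    rewrite fE -[y in RHS]/(val (exist (fun z => z \in orbit_preim U) y (mem_set Uy))).
    by rewrite fE; exact: BA.
  have Ugy : orbit_preim U (a g y) by move: Uy; rewrite -(orbit_pi_act g).
  rewrite -[a g y]/(val (exist (fun z => z \in orbit_preim U) (a g y) (mem_set Ugy))).
  rewrite fE -[y in RHS]/(val (exist (fun z => z \in orbit_preim U) y (mem_set Uy))).
  by rewrite fE; exact: et.
exists f, h; apply: val_inj.
by apply: functional_extensionality_dep => y; rewrite /= fE.
Qed.

Fact sheaf_section_subproof (U : opens O) (t : sec (equivariant_presheaf a rho) U) :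
  (godement_unit t : sec (godement _) U) \in sm_set (sheafify_sec _ U).
Proof.
rewrite inE => x; exists U, (fun=> id), t; split; first exact: set_valP.
exact: (@res_id _ _ (godement _)).
Qed.

Definition sheaf_section (U : opens O) (t : sec (equivariant_presheaf a rho) U) :
    sec S U :=
  exist (fun s => s \in sm_set (sheafify_sec _ U)) _ (sheaf_section_subproof t).

Lemma sheaf_section_res (U V : opens O) (VU : oset V `<=` oset U) t :
  res VU (@sheaf_section U t) = sheaf_section (res VU t).
Proof. by apply: val_inj; exact: godement_unit_res. Qed.

Lemma sheaf_section_linear U : linear (@sheaf_section U).
Proof. by move=> b t t'; apply: val_inj; rewrite /= linearP. Qed.

(* The germ at [x] of the section defined by [f]; zero if [f] does not define a
   section near [x]. *)
Definition eqgerm (f : Y -> E) (x : O) : stalk S x :=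
  if pselect (exists U : {U : opens O | oset U x}, equivariant_on (sval U) f)
  is left h then
    germ (proj2_sig (sval (cid h))) (sheaf_section (section_of (proj2_sig (cid h))))
  else 0.

Lemma eqgermE f x (U : opens O) (Ux : oset U x) (h : equivariant_on U f) :
  eqgerm f x = germ Ux (sheaf_section (section_of h)).
Proof.
rewrite /eqgerm; case: pselect => [h'|[]]; last by exists (exist _ U Ux).
case: cid => -[V Vx] /= hV; apply/germ_eqP.
exists (opens_meet V U), (@opens_meetl _ V U), (@opens_meetr _ V U).
split; first by split.
have hVU := equivariant_onS (@opens_meetl _ V U) hV.
by rewrite !sheaf_section_res !(section_of_res _ _ hVU).
Qed.

(** A section of the sheafification is, near each point, the family of germs of one presheaf
    section, hence of one function. *)
Lemma reg_eqgerm (c : dsec S) x : reg_at c x <->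
  exists f (U : opens O), [/\ oset U x, equivariant_on U f &
    forall w, oset U w -> c w = eqgerm f w].
Proof.
split=> [[W [s [Wx cs]]]|[f [U [Ux h cf]]]].
  have [V [VW [t [Vx e]]]] := set_valP s (exist _ x (mem_set Wx)).
  have [f [h tE]] := sectionP t.
  exists f, V; split=> // w Vw; rewrite (eqgermE Vw h) (cs w (VW w Vw)).
  rewrite -(germ_res (VW w Vw) Vw VW); congr germ.
  by apply: val_inj; rewrite -tE; exact: e.
exists U, (sheaf_section (section_of h)); split=> // w Uw.
by rewrite cf // (eqgermE Uw h).
Qed.

Lemma eqgerm_surj x (u : stalk S x) :
  exists f (U : opens O), [/\ oset U x, equivariant_on U f & u = eqgerm f x].
Proof.
have [c /reg_eqgerm[f [U [Ux h cf]]] <-] := reg_at_germ u.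
by exists f, U; split=> //; exact: cf.
Qed.

Lemma eqgerm_linear (b : k) f f' x (U U' : opens O) :
  oset U x -> oset U' x -> equivariant_on U f -> equivariant_on U' f' ->
  eqgerm (fun y => b *: f y + f' y) x = b *: eqgerm f x + eqgerm f' x.
Proof.
move=> Ux U'x h h'.
have Vx : oset (opens_meet U U') x by split.
have hV := equivariant_onS (@opens_meetl _ U U') h.
have hV' := equivariant_onS (@opens_meetr _ U U') h'.
rewrite (eqgermE Vx hV) (eqgermE Vx hV') (eqgermE Vx (equivariant_onP b hV hV')).
rewrite -germ_linear -sheaf_section_linear; congr germ; congr sheaf_section.
exact: val_inj.
Qed.

(** Unwrapping the stalk of the sheafification and then that of the presheaf, equal germs give
    functions equal over a neighbourhood of the orbit. *)
Lemma eqgerm_eval f f' (U U' : opens O) y :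
  oset U (orbit_pi y) -> oset U' (orbit_pi y) ->
  equivariant_on U f -> equivariant_on U' f' ->
  eqgerm f (orbit_pi y) = eqgerm f' (orbit_pi y) -> f y = f' y.
Proof.
move=> Uy U'y h h'; rewrite (eqgermE Uy h) (eqgermE U'y h').
move=> /germ_eqP[W [WU [WU' [Wy]]]]; rewrite !sheaf_section_res => /(congr1 val) /=.
move=> /(congr1 (fun s : dprod _ => s (exist _ (orbit_pi y) (mem_set Wy)))).
move=> /germ_eqP[V [VW [VW' [/= Vy]]]] /(congr1 val) /=.
by move=> /(congr1 (fun s => s (exist _ y (mem_set (Vy : orbit_preim V y))))).
Qed.

Hypothesis a_cont : forall g, continuous (a g).

(** The saturation of an open set is a union of its translates. *)
Lemma orbit_pi_open (V : set Y) : open V -> open (orbit_pi @` V).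
Proof.
move=> oV; rewrite -[open _]/(open (orbit_pi @^-1` (orbit_pi @` V))).
rewrite (_ : _ @^-1` _ = \bigcup_g (a g @^-1` V)).
  by apply: bigcup_open => g _; apply: open_comp => // y _; exact: a_cont.
apply/seteqP; split=> [y [v Vv /esym/orbit_piP[g e]]|y [g _ Vgy]].
  by exists g => //=; rewrite -e.
by exists (a g y) => //; exact: orbit_pi_act.
Qed.

(** Agreement at [y] spreads to a neighbourhood by local constancy and to its saturation by
    equivariance. With [eqgerm_eval], evaluation at [y] embeds the stalk in [E], also when [y] has a
    nontrivial stabilizer. *)
Lemma eqgerm_eq f f' (U U' : opens O) y :
  oset U (orbit_pi y) -> oset U' (orbit_pi y) ->
  equivariant_on U f -> equivariant_on U' f' ->
  f y = f' y -> eqgerm f (orbit_pi y) = eqgerm f' (orbit_pi y).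
Proof.
move=> Uy U'y h h' e.
have [B [oB By] Bf] : exists2 B, open_nbhs y B & forall y', B y' -> f y' = f' y'.
  have : \forall y' \near y, f y' = f' y'.
    by apply: filterS2 (h.1 y Uy) (h'.1 y U'y) => y' -> ->.
  by rewrite /prop_near1 nbhsE => -[B yB BA]; exists B.
pose V := opens_meet (Opens (orbit_pi_open oB)) (opens_meet U U').
have VU : oset V `<=` oset U by move=> w [_ []].
have VU' : oset V `<=` oset U' by move=> w [_ []].
have Vy : oset V (orbit_pi y) by split=> //; exists y.
rewrite (eqgermE Uy h) (eqgermE U'y h'); apply/germ_eqP.
exists V, VU, VU'; split=> //; rewrite !sheaf_section_res; congr sheaf_section.
apply: val_inj; apply: functional_extensionality_dep => -[z zV] /=.
have [[v Bv vz] [Uz U'z]] := set_mem zV.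
rewrite -[LHS]/(f z) -[RHS]/(f' z).
have /orbit_piP[g ->] : orbit_pi v = orbit_pi z := vz.
have Uv : oset U (orbit_pi v) by rewrite vz.
have U'v : oset U' (orbit_pi v) by rewrite vz.
by rewrite h.2 // h'.2 // Bf.
Qed.

End EquivariantStalks.

(** * Equivariant maps *)

Record equivariant_map (G : groupType) (Y Y' : topologicalType)
    (a : action G Y) (a' : action G Y') := EquivariantMap {
  emap :> Y -> Y';
  emap_cont : continuous emap;
  emapE : forall g y, emap (a g y) = a' g (emap y) }.

Section OrbitMap.
Variables (G : groupType) (Y Y' : topologicalType).
Variables (a : action G Y) (a' : action G Y') (phi : equivariant_map a a').

Definition orbit_map (x : orbit_space a) : orbit_space a' :=
  orbit_pi a' (phi (repr x)).

Lemma orbit_mapE y : orbit_map (orbit_pi a y) = orbit_pi a' (phi y).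
Proof.
have /orbit_piP[g e] : orbit_pi a y = orbit_pi a (repr (orbit_pi a y)).
  by rewrite /orbit_pi reprK.
by rewrite /orbit_map e emapE orbit_pi_act.
Qed.

Lemma orbit_map_continuous : continuous orbit_map.
Proof.
apply/quotient_continuous; rewrite (_ : _ \o _ = orbit_pi a' \o phi).
  move=> y; apply: continuous_comp; first exact: emap_cont.
  exact: orbit_pi_continuous.
by apply: funext => y; exact: orbit_mapE.
Qed.
End OrbitMap.

Section OrbitPull.
Variables (k : comNzRingType) (G : groupType) (Y Y' : topologicalType).
Variables (a : action G Y) (a' : action G Y').
Variables (E : lmodType k) (rho : representation G E).
Hypothesis a_cont : forall g, continuous (a g).
Variable phi : equivariant_map a a'.

Lemma equivariant_on_comp (U : opens (orbit_space a')) (V : opens (orbit_space a)) f :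
  oset V `<=` orbit_map phi @^-1` U ->
  equivariant_on rho U f -> equivariant_on rho V (f \o phi).
Proof.
move=> VU [lf ef]; split=> [y Vy|g y Vy] /=.
  have Uy : oset U (orbit_pi a' (phi y)) by rewrite -orbit_mapE; exact: VU.
  exact: (@emap_cont _ _ _ _ _ phi _ _ (lf _ Uy)).
by rewrite emapE ef // -orbit_mapE; exact: VU.
Qed.

Lemma orbit_map_nbhs (U : opens (orbit_space a')) x :
  oset U (orbit_map phi x) ->
  exists2 V : opens (orbit_space a), oset V x & oset V `<=` orbit_map phi @^-1` U.
Proof.
move=> Ux; apply: nbhs_opens; exact: (@orbit_map_continuous _ _ _ _ _ phi x _ (opens_nbhs Ux)).
Qed.

(** A representing function is composed with [phi]. Any representative gives the same germ, because
    a germ is determined by its value at one point of the orbit. *)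
Definition orbit_pull_at x
    (u : stalk (equivariant_sheaf a' rho) (orbit_map phi x)) :
    stalk (equivariant_sheaf a rho) x :=
  eqgerm rho (sval (cid (eqgerm_surj u)) \o phi) x.

Lemma orbit_pull_atE x (U : opens (orbit_space a')) f :
  oset U (orbit_map phi x) -> equivariant_on rho U f ->
  orbit_pull_at (eqgerm rho f (orbit_map phi x)) = eqgerm rho (f \o phi) x.
Proof.
move=> Ux h; rewrite /orbit_pull_at; case: cid => f' /= [U' [U'x h' e]].
have [V Vx VU] := orbit_map_nbhs Ux; have [V' V'x VU'] := orbit_map_nbhs U'x.
have [y xy] := orbit_pi_surj x.
move: Ux U'x e Vx V'x; rewrite -{}xy orbit_mapE => Ux U'x e Vx V'x.
apply: (eqgerm_eq a_cont V'x Vx (equivariant_on_comp VU' h')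
  (equivariant_on_comp VU h)).
exact/esym/(eqgerm_eval Ux U'x h h' e).
Qed.

Lemma orbit_pull_at_linear x : linear (@orbit_pull_at x).
Proof.
move=> b u u'; have [f [U [Ux h ->]]] := eqgerm_surj u.
have [f' [U' [U'x h' ->]]] := eqgerm_surj u'.
have Wx : oset (opens_meet U U') (orbit_map phi x) by split.
have hW := equivariant_onS (@opens_meetl _ U U') h.
have hW' := equivariant_onS (@opens_meetr _ U U') h'.
rewrite -(eqgerm_linear _ Wx Wx hW hW').
rewrite (orbit_pull_atE Wx (equivariant_onP b hW hW')).
rewrite (orbit_pull_atE Ux h) (orbit_pull_atE U'x h').
have [V Vx VU] := orbit_map_nbhs Wx.
exact: (eqgerm_linear _ Vx Vx (equivariant_on_comp VU hW)
  (equivariant_on_comp VU hW')).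
Qed.
HB.instance Definition _ x :=
  GRing.isLinear.Build k _ _ *:%R (@orbit_pull_at x) (@orbit_pull_at_linear x).

Definition orbit_morphism : stalk_morphism (orbit_map phi)
  (equivariant_sheaf a' rho) (equivariant_sheaf a rho).
Proof.
refine (@StalkMorphism _ _ _ _ _ _ (fun x => @orbit_pull_at x)
  (@orbit_map_continuous _ _ _ _ _ phi) _).
move=> c x /reg_eqgerm[f [U [Ux h cf]]]; have [V Vx VU] := orbit_map_nbhs Ux.
apply/reg_eqgerm; exists (f \o phi), V; split=> // [|w Vw].
  exact: equivariant_on_comp VU h.
by rewrite (cf _ (VU w Vw)); apply: orbit_pull_atE h; exact: VU.
Defined.

Lemma orbit_morphismE (c : dsec (equivariant_sheaf a' rho)) f
    (U : opens (orbit_space a')) x :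
  oset U (orbit_map phi x) -> equivariant_on rho U f ->
  c (orbit_map phi x) = eqgerm rho f (orbit_map phi x) ->
  pull orbit_morphism c x = eqgerm rho (f \o phi) x.
Proof. by move=> Ux h; rewrite /pull => ->; exact: orbit_pull_atE Ux h. Qed.

End OrbitPull.

Section OrbitFunctor.
Variables (k : comNzRingType) (G : groupType).
Variables (E : lmodType k) (rho : representation G E).

Lemma orbit_mapK (Y Y' : topologicalType) (a : action G Y) (a' : action G Y')
    (phi : equivariant_map a a') (psi : equivariant_map a' a) :
  cancel phi psi -> cancel (orbit_map phi) (orbit_map psi).
Proof.
by move=> phiK x; have [y <-] := orbit_pi_surj x; rewrite !orbit_mapE phiK.
Qed.

Lemma orbit_morphismK (Y Y' : topologicalType) (a : action G Y) (a' : action G Y')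
    (a_cont : forall g, continuous (a g)) (a'_cont : forall g, continuous (a' g))
    (phi : equivariant_map a a') (psi : equivariant_map a' a) :
  cancel phi psi ->
  cancel (pull (orbit_morphism rho a'_cont psi))
         (pull (orbit_morphism rho a_cont phi)).
Proof.
move=> phiK c; apply: functional_extensionality_dep => x.
have e := orbit_mapK phiK x.
have [f [U [Ux h cf]]] := eqgerm_surj (c (orbit_map psi (orbit_map phi x))).
have [V Vx VU] := orbit_map_nbhs Ux.
have hV := equivariant_on_comp VU h.
rewrite (orbit_morphismE (f := f \o psi) _ Vx hV); last first.
  exact: (orbit_morphismE _ Ux h cf).
rewrite (_ : _ \o _ = f); last by apply: funext => y /=; rewrite phiK.
by move: cf; rewrite e.
Qed.

End OrbitFunctor.

Section OrbitSquare.
Variables (k : comNzRingType) (G : groupType).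
Variables (E : lmodType k) (rho : representation G E).
Variables (Y Z Z' W : topologicalType) (a : action G Y) (b : action G Z).
Variables (b' : action G Z') (d : action G W).
Hypothesis a_cont : forall g, continuous (a g).
Hypothesis b_cont : forall g, continuous (b g).
Hypothesis b'_cont : forall g, continuous (b' g).
Variables (phi : equivariant_map a b) (psi : equivariant_map b d).
Variables (phi' : equivariant_map a b') (psi' : equivariant_map b' d).
Hypothesis phipsi : psi \o phi =1 psi' \o phi'.

Lemma orbit_map_square :
  orbit_map psi \o orbit_map phi =1 orbit_map psi' \o orbit_map phi'.
Proof.
by move=> x /=; have [y <-] := orbit_pi_surj x; rewrite !orbit_mapE;
  congr orbit_pi; exact: phipsi.
Qed.

Lemma orbit_morphism_square (c : dsec (equivariant_sheaf d rho)) :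
  pull (orbit_morphism rho a_cont phi) (pull (orbit_morphism rho b_cont psi) c) =
  pull (orbit_morphism rho a_cont phi') (pull (orbit_morphism rho b'_cont psi') c).
Proof.
apply: functional_extensionality_dep => x.
have [f [U [Ux h cf]]] := eqgerm_surj (c (orbit_map psi (orbit_map phi x))).
have e := orbit_map_square x; rewrite /= in e.
have [U'x cf'] : oset U (orbit_map psi' (orbit_map phi' x)) /\
    c (orbit_map psi' (orbit_map phi' x)) =
    eqgerm rho f (orbit_map psi' (orbit_map phi' x)) by rewrite -e.
have [V Vx VU] := orbit_map_nbhs Ux; have [V' V'x VU'] := orbit_map_nbhs U'x.
rewrite (orbit_morphismE _ Vx (equivariant_on_comp VU h)
  (orbit_morphismE b_cont Ux h cf)).
rewrite (orbit_morphismE _ V'x (equivariant_on_comp VU' h)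
  (orbit_morphismE b'_cont U'x h cf')).
rewrite (_ : (f \o psi) \o phi = (f \o psi') \o phi') //.
by apply: funext => y; exact: (congr1 f (phipsi y)).
Qed.

End OrbitSquare.

(** * The orbit space of the cylinder *)

Section Products.
Variables T U V : topologicalType.

Lemma continuous_fst : continuous (fst : U * V -> U).
Proof. by move=> [u v]; exact: cvg_fst. Qed.

Lemma continuous_snd : continuous (snd : U * V -> V).
Proof. by move=> [u v]; exact: cvg_snd. Qed.

Lemma continuous_pair (f : T -> U) (g : T -> V) :
  continuous f -> continuous g -> continuous (fun x => (f x, g x)).
Proof. by move=> cf cg x; apply: cvg_pair; [exact: cf|exact: cg]. Qed.

End Products.

Section Cylinder.
Variables (k : comNzRingType) (R : realType) (G : groupType).
Variables (Y : topologicalType) (a : action G Y).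
Variables (E : lmodType k) (rho : representation G E).
Hypothesis a_cont : forall g, continuous (a g).

Definition cylinder : topologicalType := (Y * unit_itv R)%type.

Fact cylinder_act1 (q : cylinder) : (a 1%g q.1, q.2) = q.
Proof. by rewrite act1; case: q. Qed.
Fact cylinder_actM g h (q : cylinder) :
  (a (g * h)%g q.1, q.2) = (a g (a h q.1), q.2).
Proof. by rewrite actM. Qed.

Definition cylinder_action : action G cylinder :=
  @Action G cylinder (fun g q => (a g q.1, q.2)) cylinder_act1 cylinder_actM.

Lemma cylinder_action_cont g : continuous (cylinder_action g).
Proof.
apply: continuous_pair => q; last exact: continuous_snd.
exact: (continuous_comp (@continuous_fst _ _ q) (@a_cont g q.1)).
Qed.

Fact cylinder_fst_cont : continuous (fst : cylinder -> Y).
Proof. exact: continuous_fst. Qed.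

Definition cylinder_proj : equivariant_map cylinder_action a :=
  @EquivariantMap _ _ _ cylinder_action a fst cylinder_fst_cont (fun _ _ => erefl).

Fact cylinder_incl_cont t : continuous (fun y : Y => (y, t) : cylinder).
Proof.
by apply: continuous_pair => y; [exact: cvg_id|exact: cvg_cst].
Qed.

Definition cylinder_incl t : equivariant_map a cylinder_action :=
  @EquivariantMap _ _ _ a cylinder_action _ (@cylinder_incl_cont t)
    (fun _ _ => erefl).

Definition cylinder_height (z : orbit_space cylinder_action) : unit_itv R :=
  (repr z).2.

Lemma cylinder_heightE q : cylinder_height (orbit_pi cylinder_action q) = q.2.
Proof.
have /orbit_piP[g] : orbit_pi cylinder_action q =
    orbit_pi cylinder_action (repr (orbit_pi cylinder_action q)).
  by rewrite [RHS]/orbit_pi reprK.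
by rewrite /cylinder_height => ->.
Qed.

Lemma cylinder_height_cont : continuous cylinder_height.
Proof.
apply/quotient_continuous; rewrite (_ : _ \o _ = snd); first exact: continuous_snd.
by apply: funext => q; exact: cylinder_heightE.
Qed.

(** A neighbourhood of [(y, t)] contains a box, and openness of [orbit_pi a] makes the image of that
    box a neighbourhood in the product of the orbit space with the interval. *)
Lemma orbit_cylinder_incl_cont : continuous
  (fun q : orbit_space a * unit_itv R => orbit_map (cylinder_incl q.2) q.1).
Proof.
move=> [x t]; have [y <-] := orbit_pi_surj x.
rewrite /continuous_at /= orbit_mapE => W.
move=> /(@orbit_pi_continuous _ _ cylinder_action) [[A B] /= [Ay Bt] AB].
move: Ay; rewrite nbhsE => -[A' [oA' A'y] A'A].
have nA' : nbhs (orbit_pi a y) (orbit_pi a @` A').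
  by apply: open_nbhs_nbhs; split; [exact: orbit_pi_open|exists y].
exists (orbit_pi a @` A', B); first by split.
move=> [_ s] [/= [y' A'y' <-] Bs]; rewrite orbit_mapE.
by apply: (AB (y', s)); split=> //; exact: A'A.
Qed.

Lemma cylinder_homotopy n t
    (c : dsec (godement_syz (equivariant_sheaf cylinder_action rho) n)) :
  (forall z, reg_at c z) ->
  coboundary
    (pull (syz_morphism (orbit_morphism rho a_cont (cylinder_incl t)) n) c -
     pull (syz_morphism (orbit_morphism rho a_cont (cylinder_incl (itv0 R))) n) c).
Proof.
apply: (@homotopy_coboundary k R _ _ _ _
  (fun s => orbit_map (cylinder_incl s)) (orbit_map cylinder_proj) cylinder_height
  _ _ _ orbit_cylinder_incl_cont cylinder_height_cont
  (orbit_morphism rho cylinder_action_cont cylinder_proj)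
  (fun s => orbit_morphism rho a_cont (cylinder_incl s))).
- move=> z; have [[y s] <-] := orbit_pi_surj z.
  by rewrite cylinder_heightE orbit_mapE orbit_mapE.
- by move=> s; apply: orbit_mapK.
- by move=> s x; have [y <-] := orbit_pi_surj x; rewrite orbit_mapE cylinder_heightE.
- by move=> s; apply: orbit_morphismK.
(* Making [f] constant along fibres, with its values at height [s], keeps its value at a point of
   height [s], hence its germ there. *)
move=> {}c s x; have [f [U [Ux h cf]]] := eqgerm_surj (c (orbit_map (cylinder_incl s) x)).
have [V Vx VU] := orbit_map_nbhs Ux.
have hV := equivariant_on_comp VU h.
have iK : orbit_map cylinder_proj (orbit_map (cylinder_incl s) x) = x by apply: orbit_mapK.
have Vx' : oset V (orbit_map cylinder_proj (orbit_map (cylinder_incl s) x)) by rewrite iK.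
have [W Wx WV] := orbit_map_nbhs Vx'.
rewrite (orbit_morphismE _ Vx' hV); last first.
  by rewrite iK; exact: (orbit_morphismE _ Ux h cf).
rewrite cf; have [y xy] := orbit_pi_surj x.
move: Ux Wx; rewrite -xy orbit_mapE => Ux Wx.
exact: (eqgerm_eq cylinder_action_cont Wx Ux (equivariant_on_comp WV hV) h).
Qed.

End Cylinder.

(** * Equivariant deformation retractions *)

Section Retraction.
Variables (k : comNzRingType) (R : realType) (G : groupType).
Variables (Y : topologicalType) (a : action G Y).
Variables (E : lmodType k) (rho : representation G E).
Hypothesis a_cont : forall g, continuous (a g).
Variables (S : set Y) (Sinv : action_invariant a S) (h : Y * R -> Y).
Hypothesis hretr : equivariant_deformation_retraction a S h.

Let a0 := sub_action Sinv.

Lemma sub_action_cont g : continuous (a0 g).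
Proof.
apply: continuous_comp_initial => y.
apply: (@continuous_comp _ _ _ set_val (a g)); last exact: a_cont.
exact: initial_continuous.
Qed.

(** [h] is continuous only within heights in [0, 1], so it is reached through a map [j] into that
    subtype. *)
Lemma itv_homotopy_cont : continuous (fun q : cylinder R Y => h (q.1, itv_val q.2)).
Proof.
have [/subspace_sigL_continuousP hc _ _ _ _] := hretr.
have mem (q : cylinder R Y) : (q.1, itv_val q.2) \in [set: Y] `*` `[0, 1]%classic.
  by rewrite inE; split=> //=; rewrite in_itv /= unit_itvP.
pose j (q : cylinder R Y) : set_type ([set: Y] `*` `[0, 1]%classic) :=
  exist (fun z => z \in [set: Y] `*` `[0, 1]%classic) _ (mem q).
have jc : continuous j.
  apply: continuous_comp_initial; apply: continuous_pair; first exact: continuous_fst.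
  move=> q; apply: continuous_comp; first exact: continuous_snd.
  exact: itv_val_continuous.
by move=> q; exact: (continuous_comp (jc q) (hc (j q))).
Qed.

Fact itv_homotopyE g (q : cylinder R Y) :
  h ((cylinder_action R a g q).1, itv_val (cylinder_action R a g q).2) =
  a g (h (q.1, itv_val q.2)).
Proof. by have [_ _ _ _ ->] := hretr; last exact: unit_itvP. Qed.

Definition itv_homotopy : equivariant_map (cylinder_action R a) a :=
  EquivariantMap itv_homotopy_cont itv_homotopyE.

Fact retraction_subproof y : h (y, 1) \in S.
Proof. by rewrite inE; have [_ _ hS _ _] := hretr. Qed.

Definition retract (y : Y) : set_type S :=
  exist (fun z => z \in S) _ (retraction_subproof y).

Lemma retract_cont : continuous retract.
Proof.
apply: continuous_comp_initial => y.
exact: (continuous_comp (@cylinder_incl_cont R Y (itv1 R) y)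
  (@itv_homotopy_cont (y, itv1 R))).
Qed.

Fact retractE g y : retract (a g y) = a0 g (retract y).
Proof.
apply: val_inj => /=; have [_ _ _ _ ->] := hretr => //.
by rewrite ler01 lexx.
Qed.

Definition retraction : equivariant_map a a0 :=
  EquivariantMap retract_cont retractE.

Definition inclusion : equivariant_map a0 a :=
  @EquivariantMap _ _ _ a0 a set_val (@initial_continuous _ _ _) (fun _ _ => erefl).

Theorem retraction_cohomology n : exists f :
  {linear sheaf_cohomology (equivariant_sheaf a rho) n ->
          sheaf_cohomology (equivariant_sheaf a0 rho) n}, bijective f.
Proof.
pose i := orbit_morphism rho sub_action_cont inclusion.
pose r := orbit_morphism rho a_cont retraction.
pose hm := orbit_morphism rho (cylinder_action_cont a_cont) itv_homotopy.
have [_ h0 _ h1 _] := hretr.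
(* Restriction to [S], with the pull-back along the retraction as inverse. *)
exists (cohomology_pull i n), (cohomology_pull r n) => u.
  have [c [rc ->]] := cohomology_elim u.
  rewrite !cohomology_pullE; apply: cohomology_class_eq.
  have := @cylinder_homotopy k R G Y a E rho a_cont n (itv1 R)
    (pull (syz_morphism hm n) c) (fun z => pull_reg (syz_morphism hm n) (rc _)).
  (* At height 0 the homotopy is the identity. *)
  rewrite [X in _ - X](@syz_morphismK _ _ _ _ _ _ _ _ hm); last 2 first.
  - by apply: orbit_mapK => y /=; exact: h0.
  - by apply: orbit_morphismK => y /=; exact: h0.
  (* At height 1 it is the inclusion after the retraction. *)
  rewrite (@syz_morphism_square _ _ _ _ _ _ _ _ _ _ _ _ _ _ _ r i) //.
  - by apply: orbit_map_square.
  - by apply: orbit_morphism_square.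
have [c [rc ->]] := cohomology_elim u.
rewrite !cohomology_pullE; apply: cohomology_class_eq.
(* The other composition is the identity already on cochains, as the retraction fixes [S]. *)
have retrK : cancel inclusion retraction.
  by move=> y; apply: val_inj => /=; apply: h1; exact: set_valP.
rewrite [X in X - _](@syz_morphismK _ _ _ _ _ _ _ i r); last 2 first.
- exact: orbit_mapK.
- exact: orbit_morphismK.
by rewrite subrr; case: n c {u rc} => [|n] c //=; exists 0; rewrite linear0.
Qed.

End Retraction.

(** * Continuity of translations on the homogeneous space *)

Lemma continuous_mx (T U : topologicalType) (m n : nat) (f : T -> 'M[U]_(m, n)) :
  (forall i j, continuous (fun x => f x i j)) -> continuous f.
Proof.
move=> cf x A [P Px PA].
suff : \forall y \near x, forall i j, P i j (f y i j).
  by apply: filterS => y Py; apply: PA.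
apply: filter_forall => i; apply: filter_forall => j.
exact: (cf i j x _ (Px i j)).
Qed.

Lemma GL_mul_continuous (R : realType) (n : nat) (g : GL n R) :
  continuous (fun x : GL n R => (g * x)%g).
Proof.
apply: continuous_comp_initial => x.
have vc : continuous (val : GL n R -> 'M[R]_n) by exact: initial_continuous.
have mc : continuous (fun A : 'M[R]_n => val g *m A).
  apply: continuous_mx => i j; under eq_fun do rewrite mxE.
  apply: continuous_big => [|l _]; first exact: add_continuous.
  move=> A; apply: (@continuous_comp _ _ _ (fun A : 'M[R]_n => A l j)
    ( *%R (val g i l))); [exact: coord_continuous|exact: mulrl_continuous].
exact: (continuous_comp (vc x) (mc (val x))).
Qed.

(** The quotient topology reduces this to left multiplication, which is linear in the matrix
    entries. *)
Lemma translate_continuous (R : realType) (n : nat) (H : subgroup (GL n R))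
    (K : subgroup (elt H)) (g : elt H) : continuous (@translate R n H K g).
Proof.
apply/quotient_continuous.
rewrite (_ : _ \o _ = (\pi_(hspace K) \o (fun x => g * x)%g)); last first.
  by apply: funext => x; exact: translate_pi.
have vc : continuous (set_val : elt H -> GL n R) by exact: initial_continuous.
move=> x; apply: continuous_comp; last exact: pi_continuous.
apply: (@continuous_comp_initial _ _ _ (set_val : elt H -> GL n R)) => {}x.
exact: (continuous_comp (vc x) (@GL_mul_continuous R n (val g) (val x))).
Qed.

Theorem theorem10p5
  (R : realType) (n : nat)
  (G : subgroup (GL n R[i])) (GQ : defined_over_rat G) (Gss : semisimple G)
  (K : subgroup (elt (real_points G))) (Kmax : maximal_compact K)
  (Dnc : ~ compact [set: hspace K])
  (Gam : subgroup (GL n rat)) (GamA : arithmetic G Gam)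
  (D0 : set (hspace K))
  (D0inv : action_invariant (arith_action K (proj1 GamA)) D0)
  (h : hspace K * R -> hspace K)
  (hretr :
     equivariant_deformation_retraction (arith_action K (proj1 GamA)) D0 h)
  (cw : cw_structure R (set_type D0))
  (cwfix : stabilizers_fix_cells cw (sub_action D0inv))
  (d : nat) (Gamvcd : is_vcd (elt Gam) d) (cwdim : is_cw_dim cw d)
  (k : comNzRingType) (E : lmodType k) (rho : representation (elt Gam) E)
  (q : nat) :
  exists f :
    {linear sheaf_cohomology
              (equivariant_sheaf (arith_action K (proj1 GamA)) rho) q ->
            sheaf_cohomology (equivariant_sheaf (sub_action D0inv) rho) q},
    bijective f.
Proof.
by apply: retraction_cohomology hretr q => g; exact: translate_continuous.
Qed.
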